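(* Let $k$ be an integer with $|k|\ge 3$ and let $\lambda_\alpha,\lambda_\beta,\lambda_\gamma$ be such that $G_\alpha^\circ\simeq G_\beta^\circ\simeq G_\gamma^\circ\simeq G_a$ (notation of the context). 1. Put $\Phi=\int \omega\, y_1 x_1^2\,dz$, where $x_1$, $y_1$ are nonzero algebraic solutions of $x''=r_\alpha x$, $y''=r_\gamma y$ respectively. If the differential Galois group of $\mathrm{VE}_{2,\alpha}^{\gamma}$ is virtually Abelian, then there are constants $d_\gamma,d_\alpha\in\mathbb{C}$ such that $\Phi+d_\gamma I_\gamma$ and $\Phi+d_\alpha I_\alpha$ are both algebraic over $\mathbb{C}(z)$. 2. Put $\Phi=\int \omega\, u_1y_1x_1\,dz$, where $x_1$, $y_1$, $u_1$ are nonzero algebraic solutions of $x''=r_\alpha x$, $y''=r_\beta y$, $u''=r_\gamma u$ respectively. If the differential Galois group of $\mathrm{EX}_{2,\alpha,\beta}^{\gamma}$ is virtually Abelian, then there are constants $d_\gamma,d_\beta,d_\alpha\in\mathbb{C}$ such that $\Phi+d_\gamma I_\gamma$, $\Phi+d_\beta I_\beta$ and $\Phi+d_\alpha I_\alpha$ are all algebraic over $\mathbb{C}(z)$.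
   Context: Derivation $'=d/dz$. For an integer $k$ with $|k|\ge3$ and $\lambda\in\mathbb{C}$ put $$r_\lambda(z)=\frac{\rho^2-1}{4z^2}+\frac{\sigma^2-1}{4(z-1)^2}-\frac14(1-\rho^2-\sigma^2+\tau^2)\Big(\frac1z+\frac1{1-z}\Big),\quad \rho=\frac1k,\ \sigma=\frac12,\ \tau^2=\frac{(k-2)^2+8k\lambda}{4k^2}.$$ Write $r_\nu=r_{\lambda_\nu}$ for $\nu\in\{\alpha,\beta,\gamma\}$. Let $\omega=z^{-(\frac32+\frac1{2k})}(z-1)^{-5/4}$ and $K_0=\mathbb{C}(z)[\omega]$ (a finite Abelian extension of $\mathbb{C}(z)$). The systems considered, over $K_0$, are $$\mathrm{VE}_{2,\alpha}^{\gamma}:\ x''=r_\alpha x,\quad y''=r_\gamma y+\omega x^2;\qquad \mathrm{EX}_{2,\alpha,\beta}^{\gamma}:\ x''=r_\alpha x,\quad y''=r_\beta y,\quad u''=r_\gamma u+\omega xy .$$ Their differential Galois groups are those of their Picard–Vessiot extensions of $K_0$ (with constants $\mathbb{C}$); a group is virtually Abelian if its identity component is Abelian. $G_\nu$ is the differential Galois group of $w''=r_\nu w$ over $\mathbb{C}(z)$ and $G_a$ is the additive group. By the Morales–Ramis classification, $G_\nu^\circ\simeq G_a$ for $\lambda_\nu=p+\frac k2p(p-1)$ with $p\in\mathbb{Z}$. In this case $w''=r_\nu w$ has, up to a constant factor, a unique nonzero solution $w_1$ algebraic over $\mathbb{C}(z)$; one puts $I_\nu=\int \frac{dz}{w_1^2}$,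 so that $w_1I_\nu$ is a second solution. *)

(* Defs.v *)
From HB Require Import structures.
From mathcomp Require Import all_boot all_order all_algebra.
From mathcomp Require Import fraction boolp classical_sets functions topology.
From mathcomp Require Import mpoly ring.

Set Implicit Arguments.
Unset Strict Implicit.
Unset Printing Implicit Defensive.

Import GRing.Theory.
Local Open Scope classical_set_scope.
Local Open Scope ring_scope.

(** * The Zariski topology on n x n matrices *)

(* A copy of 'M[C]_n, so as not to interfere with the product topology that
   matrices over a topological ring already carry. *)
Definition zariski (C : fieldType) (n : nat) : Type := 'M[C]_n.

HB.instance Definition _ (C : fieldType) (n : nat) := Choice.on (zariski C n).

Definition mx_eval (C : fieldType) (n : nat) (p : {mpoly C[n * n]})
    (g : 'M[C]_n) : C :=
  p.@[fun i => mxvec g 0 i].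

Definition principal_open (C : fieldType) (n : nat) (p : {mpoly C[n * n]}) :
    set (zariski C n) :=
  [set g | mx_eval p g != 0].

HB.instance Definition _ (C : fieldType) (n : nat) :=
  @isSubBaseTopological.Build (zariski C n)
    (set (zariski C n)) (range (@principal_open C n)) id.

(** * Linear algebraic groups, as sets of matrices *)

Section AlgebraicGroups.
Variables (C : fieldType) (n : nat).
Implicit Types G : set 'M[C]_n.

Definition identity_component G : set 'M[C]_n :=
  connected_component (G : set (zariski C n)) (1%:M : 'M[C]_n).

Definition abelian_mx G : Prop :=
  forall g h, G g -> G h -> g *m h = h *m g.

Definition virtually_abelian G : Prop := abelian_mx (identity_component G).

(* G is isomorphic to the additive group as an algebraic group: phi, with
   polynomial entries, is an isomorphism of groups from (C, +) onto G, and its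
   inverse is a regular function p / det^m. *)
Definition isomorphic_to_Ga G : Prop :=
  exists (phi : 'M[{poly C}]_n) (p : {mpoly C[n * n]}) (m : nat),
    let ev (t : C) : 'M[C]_n := map_mx (horner^~ t) phi in
    [/\ forall s t, ev (s + t) = ev s *m ev t,
        range ev = G
      & forall t, mx_eval p (ev t) / (\det (ev t)) ^+ m = t].

End AlgebraicGroups.

(** * Differential extensions of C(z) *)

Section Differential.
Variables (C M : fieldType).
Variable (iota : {rmorphism {fraction {poly C}} -> M}) (d : M -> M).

Definition const_in (c : C) : M := iota (tofrac c%:P).

(* (M, d) is a differential field extension of (C(z), d/dz), embedded by iota,
   whose field of constants is C.  On C(z), d/dz is the only derivation
   killing C and sending z to 1. *)
Record differential_extension : Prop := DifferentialExtension {
  derD : forall x y, d (x + y) = d x + d y;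
  derM : forall x y, d (x * y) = d x * y + x * d y;
  der_z : d (iota (tofrac 'X)) = 1;
  der_eq0 : forall x, d x = 0 <-> exists c, x = const_in c
}.

Definition field_generated (A : set M) : set M :=
  smallest (fun K : set M => divring_closed (mem K)) A.

Definition entries (n : nat) (F : 'M[M]_n) : set M :=
  [set x | exists i j, x = F i j].

Definition fundamental_matrix (n : nat) (A F : 'M[M]_n) : Prop :=
  F \in unitmx /\ map_mx d F = A *m F.

Record differential_automorphism (K L : set M) (s : M -> M) : Prop :=
  DifferentialAutomorphism {
    aut_bij : set_bij L L s;
    aut_add : {in L &, {morph s : x y / x + y}};
    aut_mul : {in L &, {morph s : x y / x * y}};
    aut_der : {in L, {morph s : x / d x}};
    aut_fix : {in K, forall x, s x = x}
  }.

(* The group of differential K-automorphisms of the Picard-Vessiot extension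
   K(F) / K, in its matrix representation s(F) = F g. *)
Definition galois_mx (K : set M) (n : nat) (F : 'M[M]_n) : set 'M[C]_n :=
  [set g | exists2 s : M -> M,
     differential_automorphism K (field_generated (K `|` entries F)) s
     & map_mx s F = F *m map_mx const_in g].

(* G is the differential Galois group over K of Y' = A Y, A having its entries
   in K.  The Picard-Vessiot extension is taken inside M, which has no
   constants outside C; another F conjugates G by an element of GL_n(C). *)
Definition is_galois_group (K : set M) (n : nat) (A : 'M[M]_n)
    (G : set 'M[C]_n) : Prop :=
  exists2 F, fundamental_matrix A F & G = galois_mx K F.

(** * The equations *)

Definition r_nu (k : int) (lambda : C) : {fraction {poly C}} :=
  let kC : C := k%:~R in
  let rho : C := kC^-1 in
  let sigma : C := 2%:R^-1 in
  let tau2 : C := ((kC - 2%:R) ^+ 2 + 8%:R * kC * lambda) / (4%:R * kC ^+ 2) in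
  let con (c : C) : {fraction {poly C}} := tofrac c%:P in
  let z : {fraction {poly C}} := tofrac 'X in
  con (rho ^+ 2 - 1) / (4%:R * z ^+ 2)
  + con (sigma ^+ 2 - 1) / (4%:R * (z - 1) ^+ 2)
  - con (4%:R^-1 * (1 - rho ^+ 2 - sigma ^+ 2 + tau2)) * (z^-1 + (1 - z)^-1).

(* A branch of z^-(3/2 + 1/(2k)) (z - 1)^-(5/4); note that
   3/2 + 1/(2k) = (3k + 1)/(2k). *)
Definition is_omega (k : int) (omega : M) : Prop :=
  let z := iota (tofrac 'X) in
  exists a b : M, [/\ a ^ (2 * k) = z ^ (- (3 * k + 1)),
                      b ^+ 4 = (z - 1) ^- 5
                    & omega = a * b].

Definition K_0 (omega : M) : set M :=
  field_generated (range iota `|` [set omega]).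

Definition mx_of_rows (n : nat) (rows : seq (seq M)) : 'M[M]_n :=
  \matrix_(i, j) (nth [::] rows i)`_j.

Definition col_of_seq (n : nat) (s : seq M) : 'cV[M]_n := \col_i s`_i.

(* w'' = r w, in the unknowns w, w' *)
Definition companion_mx (r : M) : 'M[M]_2 :=
  mx_of_rows 2 [:: [:: 0; 1];
                   [:: r; 0]].

(* The linear system attached to x'' = ra x, y'' = rg y + omega x^2, in the
   unknowns x, x', x^2, x x', x'^2, y, y' (see VE_mxP).  The quadratic system
   is not linear itself; the entries of a fundamental matrix of this one
   generate, over K_0, the same field as all the components x, x', y, y' of its
   solutions, so both have the same Picard-Vessiot extension. *)
Definition VE_mx (omega ra rg : M) : 'M[M]_7 :=
  mx_of_rows 7
    [:: [:: 0 ; 1; 0    ; 0       ; 0; 0 ; 0];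
        [:: ra; 0; 0    ; 0       ; 0; 0 ; 0];
        [:: 0 ; 0; 0    ; 2%:R    ; 0; 0 ; 0];
        [:: 0 ; 0; ra   ; 0       ; 1; 0 ; 0];
        [:: 0 ; 0; 0    ; 2%:R * ra; 0; 0 ; 0];
        [:: 0 ; 0; 0    ; 0       ; 0; 0 ; 1];
        [:: 0 ; 0; omega; 0       ; 0; rg; 0]].

(* The linear system attached to x'' = ra x, y'' = rb y, u'' = rg u + omega x y,
   in the unknowns x, x', y, y', x y, x y', x' y, x' y', u, u' (see EX_mxP);
   the remark on VE_mx applies. *)
Definition EX_mx (omega ra rb rg : M) : 'M[M]_10 :=
  mx_of_rows 10
    [:: [:: 0 ; 1; 0 ; 0; 0    ; 0 ; 0 ; 0; 0 ; 0];
        [:: ra; 0; 0 ; 0; 0    ; 0 ; 0 ; 0; 0 ; 0];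
        [:: 0 ; 0; 0 ; 1; 0    ; 0 ; 0 ; 0; 0 ; 0];
        [:: 0 ; 0; rb; 0; 0    ; 0 ; 0 ; 0; 0 ; 0];
        [:: 0 ; 0; 0 ; 0; 0    ; 1 ; 1 ; 0; 0 ; 0];
        [:: 0 ; 0; 0 ; 0; rb   ; 0 ; 0 ; 1; 0 ; 0];
        [:: 0 ; 0; 0 ; 0; ra   ; 0 ; 0 ; 1; 0 ; 0];
        [:: 0 ; 0; 0 ; 0; 0    ; ra; rb; 0; 0 ; 0];
        [:: 0 ; 0; 0 ; 0; 0    ; 0 ; 0 ; 0; 0 ; 1];
        [:: 0 ; 0; 0 ; 0; omega; 0 ; 0 ; 0; rg; 0]].

Lemma VE_mxP (omega ra rg x y : M) :
  differential_extension ->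
  d (d x) = ra * x -> d (d y) = rg * y + omega * x ^+ 2 ->
  let v := col_of_seq 7 [:: x; d x; x ^+ 2; x * d x; d x ^+ 2; y; d y] in
  map_mx d v = VE_mx omega ra rg *m v.
Proof.
move=> hd hx hy /=; apply/matrixP => i j; rewrite !mxE.
do 7! rewrite big_ord_recl; rewrite big_ord0 !mxE.
case: i => [] [|[|[|[|[|[|[|//]]]]]]] hi /=;
  rewrite ?expr2 ?(derM hd) ?hx ?hy /=; ring.
Qed.

Lemma EX_mxP (omega ra rb rg x y u : M) :
  differential_extension ->
  d (d x) = ra * x -> d (d y) = rb * y -> d (d u) = rg * u + omega * (x * y) ->
  let v := col_of_seq 10 [:: x; d x; y; d y;
                            x * y; x * d y; d x * y; d x * d y; u; d u] in
  map_mx d v = EX_mx omega ra rb rg *m v.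
Proof.
move=> hd hx hy hu /=; apply/matrixP => i j; rewrite !mxE.
do 10! rewrite big_ord_recl; rewrite big_ord0 !mxE.
case: i => [] [|[|[|[|[|[|[|[|[|[|//]]]]]]]]]] hi /=;
  rewrite ?(derM hd) ?hx ?hy ?hu /=; ring.
Qed.

Definition algebraic_solution (r : {fraction {poly C}}) (w : M) : Prop :=
  [/\ w != 0, d (d w) = iota r * w & algebraicOver iota w].

Definition is_I_nu (r : {fraction {poly C}}) (I : M) : Prop :=
  exists2 w1, algebraic_solution r w1 & d I = (w1 ^+ 2)^-1.

(* "The identity component of the differential Galois group of w'' = r w over
   C(z) is isomorphic to the additive group." *)
Definition galois_component_Ga (r : {fraction {poly C}}) : Prop :=
  exists2 G, is_galois_group (range iota) (companion_mx (iota r)) G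
           & isomorphic_to_Ga (identity_component G).

End Differential.

(* Main.v *)
Require Import Defs.
From HB Require Import structures.
From mathcomp Require Import all_boot all_order all_algebra.
From mathcomp Require Import fingroup perm fraction boolp.
From mathcomp Require Import classical_sets functions reals topology.
From mathcomp Require Import complex mpoly ring.

Set Implicit Arguments.
Unset Strict Implicit.
Unset Printing Implicit Defensive.

Import GRing.Theory Num.Theory.
Local Open Scope classical_set_scope.
Local Open Scope ring_scope.

(** Let K be the field of all elements of M that are algebraic over C(z). It
contains omega and the solutions x1, y1, u1, and variation of constants turns
each of the two systems into a unipotent one over K (VE_gauge_der,
EX_gauge_der): it has an upper unipotent fundamental matrix T, whose entries are
iterated integrals. For instance y = y1 p, where p' = q / y1^2 and
q' = omega y1 x^2. Among the entries of T just above the diagonal are I_gamma,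
Phi, I_alpha (and I_beta), up to constant factors and constants of integration;
Phi is next to I_gamma because of the solutions with x = x1, and next to I_alpha
because of those with x = x1 + x1 I_alpha.

An automorphism over K multiplies T by a constant unipotent matrix g. If f and h
are consecutive entries just above the diagonal, g translates them by constants
a and b, and the commutator of two such matrices has the entry a b' - a' b next
to them, as in the Heisenberg group. Suppose that no nontrivial combination of f
and h with constant coefficients is in K. Then f and h are algebraically
independent over K (integral_in_simple_extension, a case of Ostrowski's theorem),
so there are automorphisms of K(f, h) with (a, b) = (1, 0) and (0, 1)
(independent_translations). They extend to the whole Picard-Vessiot extension by
choosing images of the remaining entries of T one after the other: the image of
an integral is an integral of the image, and is known up to a constant
(extend_unipotent_solution). The matrices obtained are unipotent, so their powers
depend polynomially on the exponent and form a connected set containing 1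
(unipotent_powers_connected): they lie in the identity component, which is then
not Abelian. This is virtually_abelian_relation.

So Phi has a relation modulo K with each of I_gamma, I_alpha and I_beta. Its
coefficient at Phi is nonzero because the integrals I_nu are not algebraic: if one
were, all solutions of the corresponding equation would be algebraic, their
conjugates would be finite in number, and the group could not contain a copy of
the additive group (Ga_not_algebraic, Ga_integral). *)

(** * Derivations and differential subfields *)

Section Derivation.
Variables (C M : fieldType) (iota : {rmorphism {fraction {poly C}} -> M}).
Variable d : M -> M.
Hypothesis Md : differential_extension iota d.
Hypothesis char0 : forall n, n.+1%:R != 0 :> C.

Local Notation cst := (const_in iota).

Lemma const_in_is_zmod_morphism : zmod_morphism cst.
Proof. by move=> x y; rewrite /const_in !rmorphB. Qed.

Lemma const_in_is_monoid_morphism : monoid_morphism cst.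
Proof. by split=> [|x y]; rewrite /const_in ?(rmorph1, rmorphM). Qed.

HB.instance Definition _ := GRing.isZmodMorphism.Build C M (const_in iota)
  const_in_is_zmod_morphism.
HB.instance Definition _ := GRing.isMonoidMorphism.Build C M (const_in iota)
  const_in_is_monoid_morphism.

Lemma charM0 n : n.+1%:R != 0 :> M.
Proof. by rewrite -(rmorph_nat cst) fmorph_eq0. Qed.

Lemma der_const c : d (cst c) = 0.
Proof. by apply/(der_eq0 Md); exists c. Qed.

Lemma der0 : d 0 = 0. Proof. by rewrite -[X in d X](rmorph0 cst) der_const. Qed.
Lemma der1 : d 1 = 0. Proof. by rewrite -[X in d X](rmorph1 cst) der_const. Qed.

Lemma derN x : d (- x) = - d x.
Proof. by apply/eqP; rewrite -addr_eq0 -(derD Md) addNr der0. Qed.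

Lemma derB x y : d (x - y) = d x - d y.
Proof. by rewrite (derD Md) derN. Qed.

Lemma derV x : d x^-1 = - d x / x ^+ 2.
Proof.
have [->|x0] := eqVneq x 0; first by rewrite invr0 der0 oppr0 mul0r.
have := congr1 d (mulVf x0); rewrite (derM Md) der1 => /eqP.
rewrite addr_eq0 => /eqP e; apply: (mulIf x0); rewrite e; field; exact: x0.
Qed.

Lemma der_sum I (r : seq I) (P : pred I) (f : I -> M) :
  d (\sum_(i <- r | P i) f i) = \sum_(i <- r | P i) d (f i).
Proof. exact: (big_morph d (derD Md) der0). Qed.

Lemma derZ c x : d (cst c * x) = cst c * d x.
Proof. by rewrite (derM Md) der_const mul0r add0r. Qed.

Lemma der_mulmx m n p (A : 'M[M]_(m, n)) (B : 'M[M]_(n, p)) :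
  map_mx d (A *m B) = map_mx d A *m B + A *m map_mx d B.
Proof.
apply/matrixP => i j; rewrite !mxE der_sum -big_split /=.
by apply: eq_bigr => l _; rewrite !mxE (derM Md).
Qed.

Lemma der_mx_const m n (A : 'M[C]_(m, n)) : map_mx d (map_mx cst A) = 0.
Proof. by apply/matrixP => i j; rewrite !mxE der_const. Qed.

Lemma der_mx_eq0 m n (X : 'M[M]_(m, n)) :
  map_mx d X = 0 -> exists c : 'M[C]_(m, n), X = map_mx cst c.
Proof.
move=> dX0; have c0 i j : exists c, X i j = cst c.
  by apply/(der_eq0 Md); have /matrixP/(_ i j) := dX0; rewrite !mxE.
exists (\matrix_(i, j) projT1 (choice (c0 i)) j).
by apply/matrixP => i j; rewrite !mxE (projT2 (choice (c0 i))).
Qed.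

(** The derivative of T^-1 U vanishes, since that of T^-1 is - T^-1 A. *)
Lemma solution_quotient_const n m (A T : 'M[M]_n) (U : 'M[M]_(n, m)) :
    T \in unitmx -> map_mx d T = A *m T -> map_mx d U = A *m U ->
  exists h : 'M[C]_(n, m), U = T *m map_mx cst h.
Proof.
move=> Tu dT dU; have [|h e] := @der_mx_eq0 _ _ (invmx T *m U); last first.
  by exists h; rewrite -e mulKVmx.
have := congr1 (map_mx d) (mulKVmx Tu U).
rewrite der_mulmx dT dU -mulmxA mulKVmx // => /(canRL (addKr _)).
by rewrite addNr => /(congr1 (mulmx (invmx T))); rewrite mulKmx // mulmx0.
Qed.

(** divring_closed, stated for a set in Prop rather than for a boolean
predicate. *)
Record subfield (N : set M) : Prop := Subfield {
  subf1 : N 1;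
  subfB : forall x y, N x -> N y -> N (x - y);
  subfDiv : forall x y, N x -> N y -> N (x / y)
}.

Lemma subfieldP (N : set M) : GRing.divring_closed (mem N) <-> subfield N.
Proof.
split=> [[h1 h2 h3]|[h1 h2 h3]]; split.
- by move: h1; rewrite inE.
- by move=> x y Nx Ny; have := h2 x y; rewrite !inE; apply.
- by move=> x y Nx Ny; have := h3 x y; rewrite !inE; apply.
- by rewrite inE.
- by move=> x y; rewrite !inE; apply: h2.
- by move=> x y; rewrite !inE; apply: h3.
Qed.

Section Subfield.
Variables (N : set M) (sN : subfield N).

Lemma subf0 : N 0.
Proof. by have := subfB sN (subf1 sN) (subf1 sN); rewrite subrr. Qed.

Lemma subfN x : N x -> N (- x).
Proof. by move=> Nx; have := subfB sN subf0 Nx; rewrite sub0r. Qed.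

Lemma subfD x y : N x -> N y -> N (x + y).
Proof. by move=> Nx Ny; rewrite -(opprK y); apply: subfB => //; apply: subfN. Qed.

Lemma subfV x : N x -> N x^-1.
Proof. by rewrite -(mul1r x^-1); apply: subfDiv => //; apply: subf1. Qed.

Lemma subfM x y : N x -> N y -> N (x * y).
Proof. by move=> Nx Ny; rewrite -(invrK y); apply: subfDiv => //; apply: subfV. Qed.

Lemma subf_sum I (r : seq I) (P : pred I) (f : I -> M) :
  (forall i, P i -> N (f i)) -> N (\sum_(i <- r | P i) f i).
Proof. by move=> Nf; apply: big_ind => //; [apply: subf0|apply: subfD]. Qed.

Lemma subfX x n : N x -> N (x ^+ n).
Proof.
by move=> Nx; elim: n => [|n IH]; rewrite ?expr0 ?exprS;
  [apply: subf1|apply: subfM].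
Qed.

Lemma subf_nat n : N n%:R.
Proof.
elim: n => [|n IH]; first exact: subf0.
by rewrite -addn1 natrD; apply: subfD => //; apply: subf1.
Qed.

Definition coefs_in (p : {poly M}) := forall i, N p`_i.

Lemma subf_horner p x : coefs_in p -> N x -> N p.[x].
Proof.
move=> Np Nx; rewrite horner_coef; apply: subf_sum => i _.
by apply: subfM => //; apply: subfX.
Qed.

Lemma coefs_inD p q : coefs_in p -> coefs_in q -> coefs_in (p + q).
Proof. by move=> Np Nq i; rewrite coefD; apply: subfD. Qed.

Lemma coefs_inM p q : coefs_in p -> coefs_in q -> coefs_in (p * q).
Proof. by move=> Np Nq i; rewrite coefM; apply: subf_sum => j _; apply: subfM. Qed.

Lemma coefs_inC c : N c -> coefs_in c%:P.
Proof. by move=> Nc i; rewrite coefC; case: eqP => // _; apply: subf0. Qed.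

Lemma coefs_in_deriv p : coefs_in p -> coefs_in p^`().
Proof.
by move=> Np i; rewrite coef_deriv -mulr_natr; apply: subfM => //; apply: subf_nat.
Qed.

Hypothesis dN : forall x, N x -> N (d x).

Lemma coefs_in_map_der p : coefs_in p -> coefs_in (map_poly d p).
Proof. by move=> Np i; rewrite coef_map_id0 ?der0 //; apply: dN. Qed.

End Subfield.

Lemma der_horner p x : d p.[x] = (map_poly d p).[x] + p^`().[x] * d x.
Proof.
elim/poly_ind: p => [|p c IH].
  by rewrite horner0 map_poly0 deriv0 !horner0 der0 mul0r addr0.
have -> : map_poly d (p * 'X + c%:P) = map_poly d p * 'X + (d c)%:P.
  apply/polyP => i; rewrite coef_map_id0 ?der0 // !coefD !coefMX !coefC.
  by case: i => [|i]; rewrite (derD Md) ?coef_map_id0 ?der0.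
rewrite !hornerE (derD Md) (derM Md) IH derivD derivM derivX derivC !hornerE.
ring.
Qed.

(** Take a relation p(f) = 0 of minimal degree m > 0, with p monic. Its
derivative is a relation of smaller degree, so it vanishes identically, and its
coefficient of degree m - 1 says that m f + p_(m-1) is a constant. *)
Lemma integral_transcendental (N : set M) f p :
    subfield N -> (forall c, N (cst c)) -> (forall x, N x -> N (d x)) ->
    N (d f) -> ~ N f -> coefs_in N p -> p.[f] = 0 ->
  p = 0.
Proof.
move=> sN Nc dN Ndf Nf; have [n le_pn] := ubnP (size p).
elim: n p le_pn => // n IH p le_pn Np pf0; apply: contrapT => /eqP p0.
have lc0 : lead_coef p != 0 by rewrite lead_coef_eq0.
pose q := (lead_coef p)^-1%:P * p.
have Nq : coefs_in N q.
  by apply: coefs_inM => //; apply: coefs_inC => //; apply: subfV => //; apply: Np.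
have qf0 : q.[f] = 0 by rewrite hornerM pf0 mulr0.
have sq : size q = size p.
  by rewrite /q mul_polyC size_scale // invr_eq0.
have lq : lead_coef q = 1.
  by rewrite lead_coefM lead_coefC mulVf.
have q0 : q != 0 by rewrite -lead_coef_eq0 lq oner_neq0.
case E : (size q) => [|[|m]].
- by move/eqP: E; rewrite size_poly_eq0 (negPf q0).
- move: qf0 lq; rewrite (size1_polyC (eq_leq E)) hornerC lead_coefC => ->.
  by move/eqP; rewrite eq_sym oner_eq0.
have qm1 : q`_m.+1 = 1 by rewrite -lq lead_coefE E.
pose r := map_poly d q + q^`() * (d f)%:P.
have r0 : r = 0.
  apply: IH.
  - apply: leq_trans (_ : m.+2 <= n)%N; last by rewrite -E sq.
    rewrite ltnS; apply/leq_sizeP => j; rewrite leq_eqVlt => /orP[/eqP<-|lt_mj].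
      rewrite coefD coef_map_id0 ?der0 // qm1 der1 coefMC coef_deriv.
      by rewrite (leq_sizeP q m.+2 _) ?E // mul0rn mul0r addr0.
    rewrite coefD coef_map_id0 ?der0 // coefMC coef_deriv.
    by rewrite !(leq_sizeP q m.+2 _) ?E ?der0 ?mul0rn ?mul0r ?addr0 // ltnW.
  - apply: coefs_inD => //; first exact: coefs_in_map_der.
    by apply: coefs_inM => //; [apply: coefs_in_deriv|apply: coefs_inC].
  - by rewrite /r hornerD hornerM hornerC -der_horner qf0 der0.
have /polyP/(_ m) := r0.
rewrite coefD coef_map_id0 ?der0 // coefMC coef_deriv qm1 coef0 => e.
have [c ec] : exists c, q`_m + m.+1%:R * f = cst c.
  apply/(der_eq0 Md); rewrite (derD Md) -[X in d (X * f)](rmorph_nat cst) derZ.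
  by rewrite rmorph_nat.
apply: Nf; suff -> : f = (cst c - q`_m) / m.+1%:R.
  by apply: subfDiv => //; [apply: subfB|apply: subf_nat].
by rewrite -ec addrC addKr mulrC mulKf ?charM0.
Qed.

End Derivation.

(** * Extending differential isomorphisms along integrals *)

Section Isomorphisms.
Variables (C M : fieldType) (iota : {rmorphism {fraction {poly C}} -> M}).
Variable d : M -> M.
Hypothesis Md : differential_extension iota d.
Hypothesis char0 : forall n, n.+1%:R != 0 :> C.

Local Notation cst := (const_in iota).

(** The graph of a differential automorphism of a subfield of M, trivial on
constants. Working with the graph rather than with a function keeps the two
sides symmetric, and makes extending an automorphism a matter of closing a set
under field operations. Both projections of the graph are the same subfield, by
the last two conditions; it is a bijection because of aut_eq0. *)
Record aut_graph (S : M -> M -> Prop) : Prop := AutGraph {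
  autB : forall x x' y y', S x x' -> S y y' -> S (x - y) (x' - y');
  autDiv : forall x x' y y', S x x' -> S y y' -> S (x / y) (x' / y');
  aut_derive : forall x x', S x x' -> S (d x) (d x');
  aut_const : forall c, S (cst c) (cst c);
  aut_eq0 : forall x x', S x x' -> (x = 0 <-> x' = 0);
  aut_into : forall x x', S x x' -> exists y, S x' y;
  aut_onto : forall x x', S x x' -> exists y, S y x
}.

Definition domain (S : M -> M -> Prop) : set M := [set x | exists x', S x x'].

Definition coefs_rel (S : M -> M -> Prop) (p q : {poly M}) : Prop :=
  forall i, S p`_i q`_i.

Definition rel_mx (S : M -> M -> Prop) m n (X Y : 'M[M]_(m, n)) : Prop :=
  forall i j, S (X i j) (Y i j).

Section Graph.
Variables (S : M -> M -> Prop) (autS : aut_graph S).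

Lemma aut1 : S 1 1. Proof. by rewrite -(rmorph1 cst); apply: aut_const. Qed.
Lemma aut0 : S 0 0. Proof. by rewrite -(rmorph0 cst); apply: aut_const. Qed.

Lemma autN x x' : S x x' -> S (- x) (- x').
Proof. by move=> h; rewrite -(sub0r x) -(sub0r x'); apply: autB => //; apply: aut0. Qed.

Lemma autD x x' y y' : S x x' -> S y y' -> S (x + y) (x' + y').
Proof.
by move=> h h'; rewrite -(opprK y) -(opprK y'); apply: autB => //; apply: autN.
Qed.

Lemma autV x x' : S x x' -> S x^-1 x'^-1.
Proof. by move=> h; rewrite -(div1r x) -(div1r x'); apply: autDiv => //; apply: aut1. Qed.

Lemma autM x x' y y' : S x x' -> S y y' -> S (x * y) (x' * y').
Proof.
by move=> h h'; rewrite -(invrK y) -(invrK y'); apply: autDiv => //; apply: autV.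
Qed.

Lemma aut_sum I (r : seq I) (P : pred I) (f f' : I -> M) :
    (forall i, P i -> S (f i) (f' i)) ->
  S (\sum_(i <- r | P i) f i) (\sum_(i <- r | P i) f' i).
Proof. by move=> h; apply: big_ind2 => //; [apply: aut0|move=> *; apply: autD]. Qed.

Lemma autX x x' n : S x x' -> S (x ^+ n) (x' ^+ n).
Proof.
by move=> h; elim: n => [|n IH]; rewrite ?expr0 ?exprS; [apply: aut1|apply: autM].
Qed.

Lemma aut_nat n : S n%:R n%:R.
Proof. by rewrite -(rmorph_nat cst); apply: aut_const. Qed.

Lemma aut_fun x y y' : S x y -> S x y' -> y = y'.
Proof.
move=> h h'; have := autB autS h h'; rewrite subrr => /(aut_eq0 autS) [e _].
by apply/eqP; rewrite -subr_eq0 e.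
Qed.

Lemma aut_inj x x' y : S x y -> S x' y -> x = x'.
Proof.
move=> h h'; have := autB autS h h'; rewrite subrr => /(aut_eq0 autS) [_ e].
by apply/eqP; rewrite -subr_eq0 e.
Qed.

Lemma coefs_relD p p' q q' :
  coefs_rel S p p' -> coefs_rel S q q' -> coefs_rel S (p + q) (p' + q').
Proof. by move=> h h' i; rewrite !coefD; apply: autD. Qed.

Lemma coefs_relN p p' : coefs_rel S p p' -> coefs_rel S (- p) (- p').
Proof. by move=> h i; rewrite !coefN; apply: autN. Qed.

Lemma coefs_relM p p' q q' :
  coefs_rel S p p' -> coefs_rel S q q' -> coefs_rel S (p * q) (p' * q').
Proof. by move=> h h' i; rewrite !coefM; apply: aut_sum => j _; apply: autM. Qed.

Lemma coefs_relC c c' : S c c' -> coefs_rel S c%:P c'%:P.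
Proof. by move=> h i; rewrite !coefC; case: eqP => // _; apply: aut0. Qed.

Lemma coefs_relX : coefs_rel S 'X 'X.
Proof. by move=> i; rewrite coefX; apply: aut_nat. Qed.

Lemma coefs_rel_deriv p p' : coefs_rel S p p' -> coefs_rel S p^`() p'^`().
Proof.
move=> h i; rewrite !coef_deriv -(mulr_natr p`_ _) -(mulr_natr p'`_ _).
by apply: autM => //; apply: aut_nat.
Qed.

Lemma coefs_rel_map_der p p' :
  coefs_rel S p p' -> coefs_rel S (map_poly d p) (map_poly d p').
Proof.
by move=> h i; rewrite !coef_map_id0 ?(der0 Md) //; apply: aut_derive.
Qed.

Lemma coefs_rel_eq0 p p' : coefs_rel S p p' -> (p = 0 <-> p' = 0).
Proof.
move=> h; split=> [p0|p0]; apply/polyP => i; rewrite coef0;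
  by apply/(aut_eq0 autS (h i)); rewrite p0 coef0.
Qed.

Lemma aut_horner p p' x x' : coefs_rel S p p' -> S x x' -> S p.[x] p'.[x'].
Proof.
move=> hp hx; rewrite (@horner_coef_wide _ (maxn (size p) (size p')) p) ?leq_maxl //.
rewrite (@horner_coef_wide _ (maxn (size p) (size p')) p') ?leq_maxr //.
by apply: aut_sum => i _; apply: autM => //; apply: autX.
Qed.

Lemma rel_mulmx m n p (A A' : 'M[M]_(m, n)) (B B' : 'M[M]_(n, p)) :
  rel_mx S A A' -> rel_mx S B B' -> rel_mx S (A *m B) (A' *m B').
Proof. by move=> hA hB i j; rewrite !mxE; apply: aut_sum => l _; apply: autM. Qed.

Lemma rel_mx_const m n (c : 'M[C]_(m, n)) : rel_mx S (map_mx cst c) (map_mx cst c).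
Proof. by move=> i j; rewrite !mxE; apply: aut_const. Qed.

Lemma subfield_domain : subfield (domain S).
Proof.
split; first by exists 1; apply: aut1.
- by move=> x y [x' h] [y' h']; exists (x' - y'); apply: autB.
- by move=> x y [x' h] [y' h']; exists (x' / y'); apply: autDiv.
Qed.

Lemma domain_der x : domain S x -> domain S (d x).
Proof. by case=> x' h; exists (d x'); apply: aut_derive. Qed.

Lemma domain_const c : domain S (cst c).
Proof. by exists (cst c); apply: aut_const. Qed.

Lemma domain_image x : domain S x <-> exists y, S y x.
Proof.
split=> [[x' h]|[y h]]; first exact: aut_onto h.
by have [x' h'] := aut_into autS h; exists x'.
Qed.

Section Adjoin.
Variables (f n : M).
Hypotheses (Sdf : S (d f) (d f + d n)) (Dn : domain S n) (Df : ~ domain S f).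

Let g := f + n.

(** The graph of p(f) / q(f) |-> p'(g) / q'(g), where p' and q' are the images
of p and q under S. It is well defined because f and g are both transcendental
over the domain of S. *)
Definition adjoin_graph : M -> M -> Prop := fun x x' => exists p p' q q',
  [/\ coefs_rel S p p', coefs_rel S q q', q.[f] != 0, q'.[g] != 0
    & x * q.[f] = p.[f] /\ x' * q'.[g] = p'.[g]].

Let transcendental_f p : coefs_in (domain S) p -> p.[f] = 0 -> p = 0.
Proof.
apply: (integral_transcendental Md char0 subfield_domain domain_const domain_der) => //.
by exists (d f + d n).
Qed.

Let transcendental_g p : coefs_in (domain S) p -> p.[g] = 0 -> p = 0.
Proof.
apply: (integral_transcendental Md char0 subfield_domain domain_const domain_der).
  by rewrite (derD Md); apply/domain_image; exists (d f).
by move=> Dg; apply: Df; have := subfB subfield_domain Dg Dn; rewrite /g addrK.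
Qed.

Let horner_neq0 p p' : coefs_rel S p p' -> (p.[f] = 0 <-> p'.[g] = 0).
Proof.
move=> h; split=> e.
- have p0 : p = 0 by apply: transcendental_f => // i; exists p'`_i; apply: h.
  by rewrite (proj1 (coefs_rel_eq0 h) p0) horner0.
- have p0 : p' = 0.
    by apply: transcendental_g => // i; apply/domain_image; exists p`_i; apply: h.
  by rewrite (proj2 (coefs_rel_eq0 h) p0) horner0.
Qed.

Let adjoin_value p p' : coefs_rel S p p' -> adjoin_graph p.[f] p'.[g].
Proof.
move=> h; exists p, p', 1, 1; split=> //.
- exact: coefs_relC aut1.
- by rewrite hornerC oner_neq0.
- by rewrite hornerC oner_neq0.
- by rewrite !hornerC !mulr1.
Qed.

Lemma adjoin_sub x x' : S x x' -> adjoin_graph x x'.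
Proof. by move=> h; have := adjoin_value (coefs_relC h); rewrite !hornerC. Qed.

Lemma adjoin_gen : adjoin_graph f g.
Proof. by have := adjoin_value coefs_relX; rewrite !hornerX. Qed.

Let adjoinB x x' y y' :
  adjoin_graph x x' -> adjoin_graph y y' -> adjoin_graph (x - y) (x' - y').
Proof.
move=> [p [p' [q [q' [hp hq q0 q0' [e e']]]]]].
move=> [r [r' [s [s' [hr hs s0 s0' [a a']]]]]].
exists (p * s - r * q), (p' * s' - r' * q'), (q * s), (q' * s').
split; rewrite ?hornerM ?mulf_neq0 //.
- by apply: coefs_relD; [|apply: coefs_relN]; apply: coefs_relM.
- exact: coefs_relM.
- by rewrite !hornerD !hornerN !hornerM -e -a -e' -a'; split; ring.
Qed.

Let adjoin_eq0 x x' : adjoin_graph x x' -> (x = 0 <-> x' = 0).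
Proof.
move=> [p [p' [q [q' [hp hq q0 q0' [e e']]]]]].
have hx : x = 0 <-> p.[f] = 0.
  by rewrite -e; split=> [->|/eqP]; rewrite ?mul0r // mulf_eq0 (negPf q0) orbF => /eqP.
have hx' : x' = 0 <-> p'.[g] = 0.
  by rewrite -e'; split=> [->|/eqP]; rewrite ?mul0r // mulf_eq0 (negPf q0') orbF => /eqP.
by have := horner_neq0 hp; tauto.
Qed.

Let adjoinM x x' y y' :
  adjoin_graph x x' -> adjoin_graph y y' -> adjoin_graph (x * y) (x' * y').
Proof.
move=> [p [p' [q [q' [hp hq q0 q0' [e e']]]]]].
move=> [r [r' [s [s' [hr hs s0 s0' [a a']]]]]].
exists (p * r), (p' * r'), (q * s), (q' * s').
split; rewrite ?hornerM ?mulf_neq0 //; try exact: coefs_relM.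
by rewrite -e -a -e' -a'; split; ring.
Qed.

Let adjoinV x x' : adjoin_graph x x' -> adjoin_graph x^-1 x'^-1.
Proof.
move=> hx; have [x0|x0] := eqVneq x 0.
  move: (hx); rewrite x0 (proj1 (adjoin_eq0 hx) x0) invr0 => _.
  exact: adjoin_sub aut0.
have x0' : x' != 0 by apply: contra x0 => /eqP h; apply/eqP/(adjoin_eq0 hx).
move: hx => [p [p' [q [q' [hp hq q0 q0' [e e']]]]]].
exists q, q', p, p'; split=> //.
- by rewrite -e mulf_neq0.
- by rewrite -e' mulf_neq0.
- by rewrite -e -e' !mulKf.
Qed.

Let adjoin_derive x x' : adjoin_graph x x' -> adjoin_graph (d x) (d x').
Proof.
move=> [p [p' [q [q' [hp hq q0 q0' [e e']]]]]].
have hd r r' : coefs_rel S r r' -> adjoin_graph (d r.[f]) (d r'.[g]).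
  move=> hr; rewrite !(der_horner Md) (derD Md).
  have := adjoin_value (coefs_relD (coefs_rel_map_der hr)
    (coefs_relM (coefs_rel_deriv hr) (coefs_relC Sdf))).
  by rewrite !hornerD !hornerM !hornerC.
have quot y u v : v != 0 -> y * v = u -> d y = (d u - u / v * d v) / v.
  by move=> v0 <-; rewrite (derM Md); field.
rewrite (quot _ _ _ q0 e) (quot _ _ _ q0' e').
apply: adjoinM; last by apply/adjoinV/adjoin_value.
apply: adjoinB; first exact: hd.
by apply: adjoinM (hd _ _ hq); apply: adjoinM; [|apply: adjoinV]; apply: adjoin_value.
Qed.


(** Both projections of the extended graph are the field generated by f and the
domain of S, because g - f belongs to that domain. *)
Let adjoin_domain x : domain adjoin_graph x <-> exists y, adjoin_graph y x.
Proof.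
have sD : subfield (domain adjoin_graph).
  split; first by exists 1; apply/adjoin_sub/aut1.
  - by move=> u v [u' h] [v' h']; exists (u' - v'); apply: adjoinB.
  - by move=> u v [u' h] [v' h']; exists (u' / v'); apply: adjoinM => //; apply: adjoinV.
have sI : subfield [set x | exists y, adjoin_graph y x].
  split; first by exists 1; apply/adjoin_sub/aut1.
  - by move=> u v [u' h] [v' h']; exists (u' - v'); apply: adjoinB.
  - by move=> u v [u' h] [v' h']; exists (u' / v'); apply: adjoinM => //; apply: adjoinV.
have DD u : domain S u -> domain adjoin_graph u.
  by case=> u' h; exists u'; apply: adjoin_sub.
have DI u : domain S u -> exists y, adjoin_graph y u.
  by move/domain_image => [u' h]; exists u'; apply: adjoin_sub.
split=> [[x' [p [p' [q [q' [hp hq q0 q0' [e _]]]]]]]|[y [p [p' [q [q' [hp hq q0 q0' [_ e]]]]]]]].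
- have If : [set x | exists y, adjoin_graph y x] f.
    have -> : f = g - n by rewrite /g addrK.
    by apply: (subfB sI); [exists f; apply: adjoin_gen|apply: DI].
  have -> : x = p.[f] / q.[f] by rewrite -e mulfK.
  by apply: (subfDiv sI); apply: (subf_horner sI) => // i; apply: DI; [exists p'`_i|exists q'`_i].
- have Dg : domain adjoin_graph g.
    by apply: (subfD sD); [exists g; apply: adjoin_gen|apply: DD].
  have -> : x = p'.[g] / q'.[g] by rewrite -e mulfK.
  by apply: (subfDiv sD); apply: (subf_horner sD) => // i; apply: DD; apply/domain_image;
    [exists p`_i|exists q`_i].
Qed.

Lemma adjoin_aut_graph : aut_graph adjoin_graph.
Proof.
split.
- exact: adjoinB.
- by move=> x x' y y' h h'; apply: adjoinM => //; apply: adjoinV.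
- exact: adjoin_derive.
- by move=> c; apply: adjoin_sub; apply: aut_const autS c.
- exact: adjoin_eq0.
- by move=> x x' h; apply/adjoin_domain; exists x.
- by move=> x x' h; apply/adjoin_domain; exists x'.
Qed.

End Adjoin.

(** The image of an integral is an integral of the image. When f is in the
domain its image is already determined, up to the constant c. *)
Lemma extend_integral f n :
    S (d f) (d f + d n) -> domain S n ->
  exists S' c, [/\ aut_graph S', forall x x', S x x' -> S' x x'
    & S' f (f + n + cst c)].
Proof.
move=> Sdf Dn; have [[f' h]|Df] := pselect (domain S f); last first.
  exists (adjoin_graph f n), 0; split; first exact: adjoin_aut_graph.
    exact: adjoin_sub.
  by rewrite rmorph0 addr0; apply: adjoin_gen.
have [c ec] : exists c, f' - (f + n) = cst c.
  apply/(der_eq0 Md); rewrite (derB Md) (derD Md).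
  by rewrite (aut_fun (aut_derive autS h) Sdf) subrr.
by exists S, c; split=> //; rewrite -ec addrC subrK.
Qed.

End Graph.

(** * Solutions of unipotent systems *)

Definition unipotent (F : fieldType) n (g : 'M[F]_n) : Prop :=
  forall i j : 'I_n, (j <= i)%N -> g i j = (i == j)%:R.

(** For a row t of integrals whose derivatives are transformed by g, the entries
of t are adjoined one by one: the image of the j-th one involves, besides a
constant, only the previous ones. *)
Lemma extend_row S n (t : 'rV[M]_n) (g : 'M[C]_n) :
    aut_graph S -> unipotent g ->
    rel_mx S (map_mx d t) (map_mx d t *m map_mx cst g) ->
  exists S' (c : 'rV[C]_n), [/\ aut_graph S', forall x x', S x x' -> S' x x'
    & rel_mx S' t (t *m map_mx cst g + map_mx cst c)].
Proof.
move=> autS ug St.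
have H : forall m, exists S' (c : 'rV[C]_n),
    [/\ aut_graph S', forall x x', S x x' -> S' x x'
    & forall j : 'I_n, (j < m)%N ->
        S' (t 0 j) ((t *m map_mx cst g + map_mx cst c) 0 j)].
  elim=> [|m [S1 [c [aS1 SS1 h1]]]]; first by exists S, 0; split.
  have [lt_mn|le_nm] := ltnP m n; last first.
    by exists S1, c; split=> // j _; apply: h1; apply: leq_trans le_nm.
  pose jm := Ordinal lt_mn.
  pose n1 := \sum_(l < n | (l < m)%N) t 0 l * cst (g l jm).
  have tg : (t *m map_mx cst g) 0 jm = t 0 jm + n1.
    rewrite mxE (bigD1 jm) //= mxE ug // eqxx rmorph1 mulr1; congr (_ + _).
    rewrite /n1 big_mkcond [RHS]big_mkcond; apply: eq_bigr => l _ /=.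
    rewrite mxE -val_eqE /=; have [lt_lm|lt_ml|_] := ltngtP l m; rewrite ?eqxx //=.
    by rewrite (ug l jm (ltnW lt_ml)) -val_eqE /= gtn_eqF // rmorph0 mulr0.
  have dn1 : S1 (d (t 0 jm)) (d (t 0 jm) + d n1).
    apply: SS1; have := St 0 jm; rewrite mxE -(derD Md) -tg.
    by have -> : map_mx d t *m map_mx cst g = map_mx d (t *m map_mx cst g);
       [rewrite (der_mulmx Md) (der_mx_const Md) mulmx0 addr0|rewrite mxE].
  have Dn1 : domain S1 n1.
    apply: (subf_sum (subfield_domain aS1)) => l lt_lm.
    apply: (subfM (subfield_domain aS1)); last exact: domain_const.
    by exists ((t *m map_mx cst g + map_mx cst c) 0 l); apply: h1.
  have [S2 [a [aS2 SS2 h2]]] := extend_integral aS1 dn1 Dn1.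
  exists S2, (\row_j if j == jm then a else c 0 j); split=> //.
    by move=> x x' h; apply/SS2/SS1.
  move=> j; rewrite ltnS leq_eqVlt => /orP[/eqP ejm|lt_jm].
    have -> : j = jm by apply: val_inj.
    by rewrite mxE tg !mxE eqxx.
  have := SS2 _ _ (h1 j lt_jm); rewrite mxE [map_mx _ c _ _]mxE.
  by rewrite [X in _ -> S2 _ X]mxE [map_mx _ (\row__ _) _ _]mxE mxE -val_eqE /= ltn_eqF.
have [S' [c [aS' SS' h]]] := H n; exists S', c; split=> // i j.
by rewrite (ord1 i); apply: h.
Qed.

End Isomorphisms.

Section UnipotentSystems.
Variables (C M : fieldType) (iota : {rmorphism {fraction {poly C}} -> M}).
Variable d : M -> M.
Hypothesis Md : differential_extension iota d.
Hypothesis char0 : forall n, n.+1%:R != 0 :> C.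

Local Notation cst := (const_in iota).

Definition strictly_upper (F : fieldType) n (A : 'M[F]_n) : Prop :=
  forall i j : 'I_n, (j <= i)%N -> A i j = 0.

Lemma unipotent_blockE (F : fieldType) n (g : 'M[F]_(1 + n)) :
  unipotent g -> g = block_mx 1%:M (ursubmx g) 0 (drsubmx g).
Proof.
move=> ug; rewrite -[LHS]submxK; congr block_mx; apply/matrixP => i j;
  by rewrite !mxE ug ?(ord1 i) ?(ord1 j).
Qed.

Lemma unipotent_drsubmx (F : fieldType) n (g : 'M[F]_(1 + n)) :
  unipotent g -> unipotent (drsubmx g).
Proof. by move=> ug i j le_ji; rewrite !mxE ug. Qed.

Lemma unipotent_block (F : fieldType) n (c : 'rV[F]_n) (g : 'M[F]_n) :
  unipotent g -> unipotent (block_mx 1%:M c 0 g).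
Proof.
move=> ug i j; case: (split_ordP i) => i' ->; case: (split_ordP j) => j' ->;
  rewrite ?(ord1 i') ?(ord1 j') => le_ji.
- by rewrite block_mxEul mxE eqxx.
- by [].
- by rewrite block_mxEdl mxE.
- by rewrite block_mxEdr ug // -!val_eqE.
Qed.

Lemma strictly_upper_blockE (F : fieldType) n (A : 'M[F]_(1 + n)) :
  strictly_upper A -> A = block_mx 0 (ursubmx A) 0 (drsubmx A).
Proof.
move=> uA; rewrite -[LHS]submxK; congr block_mx; apply/matrixP => i j;
  by rewrite !mxE uA ?(ord1 i) ?(ord1 j).
Qed.

Lemma strictly_upper_drsubmx (F : fieldType) n (A : 'M[F]_(1 + n)) :
  strictly_upper A -> strictly_upper (drsubmx A).
Proof. by move=> uA i j le_ji; rewrite !mxE uA. Qed.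

Lemma unipotent_unitmx (F : fieldType) n (g : 'M[F]_n) : unipotent g -> g \in unitmx.
Proof.
elim: n g => [|n IH] g ug.
  by rewrite unitmxE det_mx00 unitr1.
move: g ug; rewrite -[n.+1]/(1 + n)%N => g ug.
rewrite (unipotent_blockE ug) unitmxE det_ublock det1 mul1r -unitmxE.
exact/IH/unipotent_drsubmx.
Qed.

(** Without its first row, U is a solution of the smaller system, which
by induction is a constant matrix times an invertible solution; the constant
matrix being onto, the integrals needed for the first row of T are constant
combinations of the entries of the first row of U. *)
Lemma unipotent_solution n m (A : 'M[M]_n) (U : 'M[M]_(n, m)) :
    strictly_upper A -> map_mx d U = A *m U -> row_free U ->
  exists T : 'M[M]_n, unipotent T /\ map_mx d T = A *m T.
Proof.
elim: n A U => [|n IH] A U uA dU fU.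
  by exists 1%:M; split; [case|apply/matrixP; case].
move: A U uA dU fU; rewrite -[n.+1]/(1 + n)%N => A U uA.
rewrite (strictly_upper_blockE uA) -{1 2}(vsubmxK U) mul_block_col map_col_mx.
rewrite !mul0mx !add0r => /eq_col_mx[du dU1] fU.
have fU1 : row_free (dsubmx U).
  have /row_freeP[V UV] := fU; apply/row_freeP; exists (rsubmx V).
  have := congr1 (@drsubmx _ 1 n 1 n) UV.
  rewrite -{1}(vsubmxK U) -{1}(hsubmxK V) mul_col_row block_mxKdr => ->.
  by apply/matrixP => i j; rewrite !mxE -val_eqE /= eqSS.
have [T1 [uT1 dT1]] := IH _ _ (strictly_upper_drsubmx uA) dU1 fU1.
have uT := unipotent_unitmx uT1.
have [h eh] := solution_quotient_const Md uT dT1 dU1.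
have /row_freeP[h' hh'] : row_free h.
  rewrite -(row_free_map cst); have /row_freeP[B] := fU1.
  rewrite eh -mulmxA => /mulmx1C e; apply/row_freeP; exists (B *m T1).
  by rewrite mulmxA.
exists (block_mx 1%:M (usubmx U *m map_mx cst h') 0 T1); split.
  exact: unipotent_block.
rewrite map_block_mx mulmx_block (der_mulmx Md) (der_mx_const Md) mulmx0 addr0.
rewrite du eh dT1 !mul0mx !mulmx0 !addr0 !add0r -!mulmxA -map_mxM hh'.
rewrite map_mx1 mulmx1; congr block_mx; apply/matrixP => i j.
  by rewrite !ord1 !mxE (der1 Md).
by rewrite !mxE (der0 Md).
Qed.

(** An automorphism fixing A acts on a fundamental matrix T of T' = A T by a
constant factor g; here it has first to be extended to the entries of T. *)
Lemma extend_unipotent_solution S n (A T : 'M[M]_n) :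
    aut_graph iota d S -> strictly_upper A -> rel_mx S A A ->
    unipotent T -> map_mx d T = A *m T ->
  exists S' (g : 'M[C]_n),
    [/\ aut_graph iota d S', forall x x', S x x' -> S' x x', unipotent g
      & rel_mx S' T (T *m map_mx cst g)].
Proof.
move=> autS; elim: n A T => [|n IH] A T uA SA uT dT.
  by exists S, 1%:M; split=> // -[].
move: A T uA SA uT dT; rewrite -[n.+1]/(1 + n)%N => A T uA SA uT.
rewrite (strictly_upper_blockE uA) (unipotent_blockE uT) map_block_mx mulmx_block.
rewrite !mul0mx !add0r => /eq_block_mx[_ dt _ dT1].
have [|S1 [g [aS1 SS1 ug Sg]]] :=
  IH _ _ (strictly_upper_drsubmx uA) _ (unipotent_drsubmx uT) dT1.
  by move=> i j; rewrite !mxE; apply: SA.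
have [|S2 [c [aS2 SS2 Sc]]] := extend_row Md char0 aS1 ug (t := ursubmx T).
  rewrite dt -mulmxA; apply: (rel_mulmx aS1) => // i j.
  by rewrite !mxE; apply/SS1/SA.
exists S2, (block_mx 1%:M c 0 g); split=> //.
- by move=> x x' h; apply/SS2/SS1.
- exact: unipotent_block.
rewrite map_block_mx mulmx_block map_mx1 map_mx0 !mul0mx !mulmx1 !mulmx0 mul1mx.
rewrite !addr0 !add0r => i j.
case: (split_ordP i) => i' ->; case: (split_ordP j) => j' ->.
- by rewrite !block_mxEul !mxE; apply: (aut_nat aS2).
- by rewrite !block_mxEur addrC; apply: Sc.
- by rewrite !block_mxEdl !mxE; apply: (aut0 aS2).
- by rewrite !block_mxEdr; apply/SS2/Sg.
Qed.


End UnipotentSystems.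

(** * Two integrals over a differential field *)

Lemma poly_roots_inj (F : fieldType) (p : {poly F}) (a : nat -> F) :
  injective a -> (forall n, p.[a n] = 0) -> p = 0.
Proof.
move=> inj_a p0; apply: contrapT => /eqP pn0.
have rp : all (root p) (map a (iota 0 (size p))).
  by apply/allP => _ /mapP[n _ ->]; apply/rootP.
have := max_poly_roots pn0 rp.
by rewrite (map_inj_uniq inj_a) iota_uniq size_map size_iota ltnn => /(_ isT).
Qed.

Lemma natr_injective (F : fieldType) :
  (forall n, n.+1%:R != 0 :> F) -> injective (fun n => n%:R : F).
Proof.
move=> char0; have lt_neq m n : (m < n)%N -> m%:R != n%:R :> F.
  move=> lt_mn; rewrite eq_sym -subr_eq0 -natrB ?(ltnW lt_mn) //.
  by have := char0 (n - m).-1; rewrite prednK // subn_gt0.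
move=> m n /eqP; have [lt_mn|lt_nm|//] := ltngtP m n.
- by rewrite (negPf (lt_neq _ _ lt_mn)).
- by rewrite eq_sym (negPf (lt_neq _ _ lt_nm)).
Qed.

Section TwoIntegrals.
Variables (C M : fieldType) (iota : {rmorphism {fraction {poly C}} -> M}).
Variable d : M -> M.
Hypothesis Md : differential_extension iota d.
Hypothesis char0 : forall n, n.+1%:R != 0 :> C.

Local Notation cst := (const_in iota).

Variable K : set M.
Hypotheses (sK : subfield K) (Kc : forall c, K (cst c)).
Hypothesis dK : forall x, K x -> K (d x).

Definition id_graph (x y : M) : Prop := K x /\ x = y.

Lemma id_aut_graph : aut_graph iota d id_graph.
Proof.
split=> [x x' y y' [Kx <-] [Ky <-]|x x' y y' [Kx <-] [Ky <-]|x x' [Kx <-]|c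
  |x x' [_ <-]|x x' [Kx <-]|x x' [Kx _]].
- by split=> //; apply: (subfB sK).
- by split=> //; apply: (subfDiv sK).
- by split=> //; apply: dK.
- by split.
- by [].
- by exists x.
- by exists x.
Qed.

Lemma id_graph_domain x : domain id_graph x <-> K x.
Proof. by split=> [[y []]|Kx] //; exists x. Qed.

Section Two.
Variables f h : M.
Hypotheses (Kdf : K (d f)) (Kdh : K (d h)) (Kf : ~ K f).

Lemma id_graph_der x c : K (d x) -> id_graph (d x) (d x + d (cst c)).
Proof. by move=> Kdx; split=> //; rewrite (der_const Md) addr0. Qed.

Let adj c := adjoin_graph id_graph f (cst c).

Let adj_aut c : aut_graph iota d (adj c).
Proof.
apply: adjoin_aut_graph => //; first exact: id_aut_graph.
- exact: id_graph_der.
- by apply/id_graph_domain.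
- by move/id_graph_domain.
Qed.

(** A case of Ostrowski's theorem. The automorphism f |-> f + 1 adds a constant
e to h, hence fixes k = h - e f, which is a quotient r(f) / q(f). Then the
polynomial k q - r, with coefficients in K(f), vanishes at f + n for every n; so
it is zero, and k is the quotient of two coefficients of r and q. *)
Lemma integral_in_simple_extension p q :
    coefs_in K p -> coefs_in K q -> q.[f] != 0 -> h * q.[f] = p.[f] ->
  exists e, K (h - cst e * f).
Proof.
move=> Kp Kq q0 hq; pose S := adj 1; have aS : aut_graph iota d S := adj_aut 1.
have SK x : K x -> S x x.
  by move=> Kx; apply: (adjoin_sub id_aut_graph); split.
have Sf : S f (f + 1).
  by rewrite -[X in f + X](rmorph1 cst); apply: (adjoin_gen id_aut_graph).
have Sp r : coefs_in K r -> coefs_rel S r r by move=> Kr i; apply: SK.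
have [h' Sh] : exists h', S h h'.
  exists (p.[f + 1] / q.[f + 1]); have -> : h = p.[f] / q.[f] by rewrite -hq mulfK.
  by apply: (autDiv aS); apply: (aut_horner aS) => //; apply: Sp.
have [e he] : exists e, h' - h = cst e.
  apply/(der_eq0 Md); rewrite (derB Md).
  by rewrite (aut_fun aS (aut_derive aS Sh) (SK _ Kdh)) subrr.
exists e; set k := h - cst e * f.
have Sk : S k k.
  have := autB aS Sh (autM aS (aut_const aS e) Sf).
  rewrite -/k; have -> : h' = h + cst e by rewrite -he addrC subrK.
  by have -> : h + cst e - cst e * (f + 1) = k by rewrite /k; ring.
pose r := p - (cst e)%:P * 'X * q.
have Kr : coefs_in K r.
  apply: (coefs_inD sK) => //; rewrite -mulNr -mulNr -polyCN.
  apply: (coefs_inM sK) => //; apply: (coefs_inM sK).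
    by apply: (coefs_inC sK); apply: (subfN sK).
  by move=> i; rewrite coefX; apply: (subf_nat sK).
have kq n : k * q.[f + n%:R] - r.[f + n%:R] = 0.
  elim: n => [|n IH].
    by rewrite addr0 /r !hornerE -hq /k; ring.
  have Sfn : S (f + n%:R) (f + n.+1%:R).
    have -> : f + n.+1%:R = f + 1 + n%:R by rewrite -natr1; ring.
    by apply: (autD aS) => //; apply: (aut_nat aS).
  have := autB aS (autM aS Sk (aut_horner aS (Sp _ Kq) Sfn)) (aut_horner aS (Sp _ Kr) Sfn).
  by rewrite IH => /(aut_eq0 aS)[-> //].
have {}kq : k%:P * q - r = 0.
  apply: (@poly_roots_inj _ _ (fun n => f + n%:R)) => [m n /addrI|n].
    exact/natr_injective/(charM0 iota char0).
  by rewrite hornerD hornerN hornerM hornerC kq.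
have qn0 : q != 0 by apply: contraNneq q0 => ->; rewrite horner0.
have : k * lead_coef q = r`_(size q).-1.
  by move/eqP: kq; rewrite subr_eq0 => /eqP <-; rewrite coefCM.
move/(canRL (mulfK _)) => ->; last by rewrite lead_coef_eq0.
by apply: (subfDiv sK); [apply: Kr|apply: Kq].
Qed.

(** Integrals with no nontrivial constant combination in K are algebraically
independent, so they can be translated independently of each other. *)
Lemma independent_translations a b :
    (forall e, ~ K (h - cst e * f)) ->
  exists S, [/\ aut_graph iota d S, forall x, K x -> S x x,
    S f (f + cst a) & S h (h + cst b)].
Proof.
move=> Kh; have aS := adj_aut a.
have Sdh : adj a (d h) (d h + d (cst b)).
  by apply: (adjoin_sub id_aut_graph); apply: id_graph_der.
have Dh : ~ domain (adj a) h.
  move=> [h' [p [p' [q [q' [hp hq q0 _ [e _]]]]]]].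
  have Kp : coefs_in K p by move=> i; have [] := hp i.
  have Kq : coefs_in K q by move=> i; have [] := hq i.
  by have [c] := integral_in_simple_extension Kp Kq q0 e; apply: Kh.
have Db := domain_const aS b.
exists (adjoin_graph (adj a) h (cst b)); split.
- exact: adjoin_aut_graph.
- by move=> x Kx; apply/(adjoin_sub aS)/(adjoin_sub id_aut_graph); split.
- exact/(adjoin_sub aS)/(adjoin_gen id_aut_graph).
- exact: adjoin_gen.
Qed.

End Two.
End TwoIntegrals.

(** * Elements of the differential Galois group *)

Section GaloisGroup.
Variables (C M : fieldType) (iota : {rmorphism {fraction {poly C}} -> M}).
Variable d : M -> M.
Hypothesis Md : differential_extension iota d.

Local Notation cst := (const_in iota).

Lemma field_generated_subfield (A : set M) : subfield (field_generated A).
Proof.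
split=> [N [/subfieldP sN _]|x y Ax Ay N sN|x y Ax Ay N sN].
- exact: subf1.
- by have [/subfieldP sN' _] := sN; apply: (subfB sN'); [apply: Ax|apply: Ay].
- by have [/subfieldP sN' _] := sN; apply: (subfDiv sN'); [apply: Ax|apply: Ay].
Qed.

Lemma sub_field_generated (A : set M) : A `<=` field_generated A.
Proof. by move=> x Ax N [_]; apply. Qed.

Lemma field_generated_min (A N : set M) :
  subfield N -> A `<=` N -> field_generated A `<=` N.
Proof. by move=> /subfieldP sN AN x; apply. Qed.

(** An automorphism over k acting on F by a constant factor preserves the field
generated by k and the entries of F, whatever its domain. *)
Lemma aut_graph_galois S (k : set M) n (F : 'M[M]_n) (g : 'M[C]_n) :
    aut_graph iota d S -> (forall c, k (cst c)) -> (forall x, k x -> S x x) ->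
    g \in unitmx -> rel_mx S F (F *m map_mx cst g) ->
  galois_mx iota d k F g.
Proof.
move=> aS kc Sk ug SF; set L := field_generated (k `|` entries F).
have sL : subfield L by apply: field_generated_subfield.
have kL x : k x -> L x by move=> kx; apply: sub_field_generated; left.
have FL i j : L (F i j) by apply: sub_field_generated; right; exists i, j.
have FcL m (c : 'M[C]_(n, m)) i j : L ((F *m map_mx cst c) i j).
  rewrite mxE; apply: (subf_sum sL) => l _; rewrite mxE.
  by apply: (subfM sL); [apply: FL|apply: kL; apply: kc].
have dom : L `<=` domain S.
  apply: field_generated_min; first exact: subfield_domain aS.
  by move=> x [kx|[i [j ->]]]; [exists x; apply: Sk|exists ((F *m map_mx cst g) i j)].
have into : L `<=` [set x | exists2 y, L y & S x y].
  apply: field_generated_min => [|x [kx|[i [j ->]]]].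
  - split; first by exists 1; [apply: (subf1 sL)|apply: (aut1 aS)].
    + move=> x y [x' Lx h] [y' Ly h']; exists (x' - y'); first exact: (subfB sL).
      exact: (autB aS).
    + move=> x y [x' Lx h] [y' Ly h']; exists (x' / y'); first exact: (subfDiv sL).
      exact: (autDiv aS).
  - by exists x; [apply: kL|apply: Sk].
  - by exists ((F *m map_mx cst g) i j).
have onto : L `<=` [set y | exists2 x, L x & S x y].
  apply: field_generated_min => [|x [kx|[i [j ->]]]].
  - split; first by exists 1; [apply: (subf1 sL)|apply: (aut1 aS)].
    + move=> x y [x' Lx h] [y' Ly h']; exists (x' - y'); first exact: (subfB sL).
      exact: (autB aS).
    + move=> x y [x' Lx h] [y' Ly h']; exists (x' / y'); first exact: (subfDiv sL).
      exact: (autDiv aS).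
  - by exists x; [apply: kL|apply: Sk].
  - exists ((F *m map_mx cst (invmx g)) i j); first exact: FcL.
    have := rel_mulmx aS SF (rel_mx_const aS (invmx g)).
    by rewrite -mulmxA -map_mxM mulmxV // map_mx1 mulmx1; apply.
pose s x := if pselect (domain S x) is left h then projT1 (cid h) else x.
have sP x y : S x y -> s x = y.
  move=> h; rewrite /s; case: pselect => [h'|[]]; last by exists y.
  by case: (cid h') => z hz /=; apply: (aut_fun aS hz h).
have Ls x : L x -> S x (s x) by case/into => y Ly h; rewrite (sP _ _ h).
exists s; last by apply/matrixP => i j; rewrite mxE; apply: sP.
split.
- split=> [x Lx|x y|y /onto[x Lx h]]; last by exists x => //; apply: sP.
    by have [y Ly h] := into _ Lx; rewrite (sP _ _ h).
  rewrite !inE => Lx Ly e; apply: (aut_inj aS (Ls _ Lx)).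
  by rewrite e; apply: Ls.
- by move=> x y; rewrite !inE => Lx Ly; apply/sP/(autD aS); apply: Ls.
- by move=> x y; rewrite !inE => Lx Ly; apply/sP/(autM aS); apply: Ls.
- by move=> x; rewrite !inE => Lx; apply/sP/(aut_derive aS); apply: Ls.
- by move=> x; rewrite !inE => kx; apply/sP/Sk.
Qed.

Definition comp_rel (S S' : M -> M -> Prop) (x z : M) : Prop :=
  exists2 y, S x y & S' y z.

Lemma comp_aut_graph S S' :
    aut_graph iota d S -> aut_graph iota d S' -> domain S = domain S' ->
  aut_graph iota d (comp_rel S S') /\ domain S = domain (comp_rel S S').
Proof.
move=> aS aS' DS.
have D x : domain S x <-> exists x', S' x x' by rewrite DS.
split; last first.
  apply/seteqP; split=> [x [y h]|x [z [y h _]]]; last by exists y.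
  by have /D[z h'] := aut_into aS h; exists z, y.
split.
- by move=> x x' y y' [u h1 h2] [v h3 h4]; exists (u - v); [apply: (autB aS)|apply: (autB aS')].
- by move=> x x' y y' [u h1 h2] [v h3 h4]; exists (u / v); [apply: (autDiv aS)|apply: (autDiv aS')].
- by move=> x x' [u h1 h2]; exists (d u); [apply: (aut_derive aS)|apply: (aut_derive aS')].
- by move=> c; exists (cst c); [apply: (aut_const aS)|apply: (aut_const aS')].
- by move=> x x' [u /(aut_eq0 aS) h1 /(aut_eq0 aS') h2]; tauto.
- move=> x x' [u h1 h2]; have [y /(ex_intro _ _)/D] := aut_into aS' h2.
  move=> _; have /D[y' h] : domain S x' by apply/D/(aut_into aS' h2).
  have [w hw] : domain S x' by apply/D; exists y'.
  by have /D[v hv] := aut_into aS hw; exists v, w.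
- move=> x x' [u h1 h2]; have /D[y hy] : domain S x by exists u.
  have [w hw] := aut_onto aS' hy.
  have /(domain_image aS)[v hv] : domain S w by apply/D; exists x.
  by exists v, w.
Qed.

(** The powers of g come from the iterates of the automorphism. *)
Lemma galois_power S (k : set M) n (F : 'M[M]_n) (g : 'M[C]_n) m :
    aut_graph iota d S -> (forall c, k (cst c)) -> (forall x, k x -> S x x) ->
    g \in unitmx -> rel_mx S F (F *m map_mx cst g) ->
  galois_mx iota d k F (g ^+ m).
Proof.
move=> aS kc Sk ug SF.
have [S' [aS' DS' Sk' SF']] : exists S', [/\ aut_graph iota d S', domain S = domain S',
    forall x, k x -> S' x x & rel_mx S' F (F *m map_mx cst (g ^+ m))].
  elim: m => [|m [S' [aS' DS' Sk' SF']]].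
    exists (id_graph (domain S)); split.
    - by apply: id_aut_graph;
        [apply: subfield_domain aS|apply: domain_const aS|apply: domain_der aS].
    - by apply/seteqP; split=> x; rewrite id_graph_domain.
    - by move=> x kx; split=> //; exists x; apply: Sk.
    - by rewrite expr0 map_mx1 mulmx1 => i j; split=> //; exists ((F *m map_mx cst g) i j).
  have [aS'' DS''] := comp_aut_graph aS aS' DS'.
  exists (comp_rel S S'); split=> //.
    by move=> x kx; exists x; [apply: Sk|apply: Sk'].
  move=> i j; exists ((F *m map_mx cst g) i j); first exact: SF.
  rewrite exprSr map_mxM mulmxA; apply: (rel_mulmx aS') => //.
  exact: (rel_mx_const aS' g).
apply: (aut_graph_galois aS') => //.
by elim: m {SF'} => [|m IH]; rewrite ?expr0 ?unitmx1 ?exprS ?unitmx_mul ?ug.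
Qed.

End GaloisGroup.

(** * Unipotent elements lie in the identity component *)

Section UnipotentPowers.
Variables (C : fieldType) (n : nat).
Hypothesis char0 : forall n, n.+1%:R != 0 :> C.

Lemma strictly_upper_nilpotent (N : 'M[C]_n) : strictly_upper N -> N ^+ n = 0.
Proof.
move=> uN; have E m (i j : 'I_n) : (j < i + m)%N -> (N ^+ m) i j = 0.
  elim: m i j => [|m IH] i j lt_j.
    by rewrite addn0 in lt_j; rewrite expr0 mxE -val_eqE gtn_eqF.
  rewrite exprS mxE big1 // => l _; have [le_li|lt_il] := leqP l i.
    by rewrite uN // mul0r.
  by rewrite IH ?mulr0 // (leq_trans lt_j) // addnS -addSn leq_add2r.
by apply/matrixP => i j; rewrite mxE E // (leq_trans (ltn_ord j)) // leq_addl.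
Qed.

Definition binomial_poly (i : nat) : {poly C} :=
  i`!%:R^-1 *: \prod_(j < i) ('X - j%:R%:P).

Lemma binomial_polyE i m : (binomial_poly i).[m%:R] = 'C(m, i)%:R.
Proof.
have nf0 : i`!%:R != 0 :> C by rewrite -(prednK (fact_gt0 i)) char0.
rewrite hornerZ; apply: (mulfI nf0); rewrite mulVKf // -natrM mulnC bin_ffact.
elim: i {nf0} => [|i IH]; first by rewrite big_ord0 hornerC.
rewrite big_ord_recr hornerM IH ffactnSr natrM !hornerE.
have [le_im|lt_mi] := leqP i m; first by rewrite natrB.
by rewrite ffact_small // !mul0r.
Qed.

(** Expand (1 + N)^m by the binomial formula, where N = g - 1 is nilpotent. *)
Lemma power_poly (g : 'M[C]_n) k : (g - 1) ^+ k = 0 ->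
  exists e : 'I_n -> 'I_n -> {poly C}, forall m i j, (g ^+ m) i j = (e i j).[m%:R].
Proof.
move=> nil; pose N := g - 1.
have Nk l : (k <= l)%N -> N ^+ l = 0.
  by move=> le_kl; rewrite -(subnK le_kl) exprD nil mulr0.
exists (fun i j => \sum_(l < k) (N ^+ l) i j *: binomial_poly l) => m i j.
have -> : g ^+ m = \sum_(l < k) N ^+ l *+ 'C(m, l).
  have -> : g = 1 + N by rewrite addrC subrK.
  rewrite exprDn_comm; last exact/esym/commr1.
  under eq_bigr do rewrite expr1n mul1r.
  have [le_km|lt_mk] := leqP k m.+1.
    rewrite [RHS](big_ord_widen _ (fun l => N ^+ l *+ 'C(m, l)) le_km).
    rewrite [RHS]big_mkcond; apply: eq_bigr => l _.
    by case: ltnP => // le_kl; rewrite Nk // mul0rn.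
  rewrite (big_ord_widen _ (fun l => N ^+ l *+ 'C(m, l)) (ltnW lt_mk)).
  rewrite big_mkcond; apply: eq_bigr => l _.
  by case: ltnP => // lt_ml; rewrite bin_small // mulr0n.
rewrite summxE horner_sum; apply: eq_bigr => l _.
by rewrite hornerZ binomial_polyE mulmxnE mulr_natr.
Qed.

Lemma mx_evalM (p q : {mpoly C[n * n]}) (g : 'M[C]_n) :
  mx_eval (p * q) g = mx_eval p g * mx_eval q g.
Proof. exact: mevalM. Qed.

(** Principal open sets form a base, being closed under intersection. *)
Lemma zariski_open_principal (U : set (zariski C n)) x : open U -> U x ->
  exists p : {mpoly C[n * n]}, principal_open p x /\ principal_open p `<=` U.
Proof.
move=> [D sD <-] [A DA Ax]; have [E sE EA] := sD _ DA.
have [p [px pA]] : exists p : {mpoly C[n * n]}, principal_open p x /\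
    forall y, principal_open p y -> forall B, B \in finmap.enum_fset E -> B y.
  have : forall B, B \in finmap.enum_fset E -> exists p, principal_open p x
      /\ principal_open p `<=` B.
    move=> B EB; have := sE B EB; rewrite inE => -[p _ pB].
    by exists p; rewrite pB; split=> //; move: Ax; rewrite -EA; apply.
  elim: (finmap.enum_fset E) => [_|B r IH H].
    exists 1; split=> //; rewrite /principal_open /= /mx_eval meval1.
    exact: oner_neq0.
  have [p [px pr]] : exists p : {mpoly C[n * n]}, principal_open p x /\
      forall y, principal_open p y -> forall B, B \in r -> B y.
    by apply: IH => B' rB'; apply: H; rewrite inE rB' orbT.
  have [q [qx qB]] := H B (mem_head _ _).
  exists (q * p); rewrite /principal_open /= mx_evalM mulf_neq0 //; split=> // y.
  rewrite mx_evalM mulf_eq0 negb_or => /andP[qy py] B'.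
  by rewrite inE => /predU1P[->|]; [apply: qB|apply: pr].
exists p; split=> // y py; exists A => //.
by change (A y); rewrite -EA => B EB; apply: pA.
Qed.

(** The powers of a unipotent matrix depend polynomially on the exponent, so a
nonempty open subset contains all of them but finitely many. *)
Lemma unipotent_powers_connected (g : 'M[C]_n) k : (g - 1) ^+ k = 0 ->
  connected (range (fun m => g ^+ m) : set (zariski C n)).
Proof.
move=> nil; have Q p : exists q : {poly C}, forall m, mx_eval p (g ^+ m) = q.[m%:R].
  have [e he] := power_poly nil.
  exists (\sum_(u <- msupp p) p@_u *: \prod_(i < n * n)
    (mxvec (\matrix_(a < n, b < n) e a b) 0 i) ^+ u i) => m.
  rewrite /mx_eval mevalE horner_sum; apply: eq_bigr => u _.
  rewrite hornerZ horner_prod; congr (_ * _); apply: eq_bigr => i _.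
  by rewrite horner_exp; case/mxvec_indexP: i => a b; rewrite !mxvecE mxE he.
move=> B [x Bx] [U oU BU] [V cV BV]; apply/seteqP; split=> [y|y Ay].
  by rewrite BU => -[].
apply: contrapT => nBy; have Vy : (~` V) y.
  by move=> Vy; apply: nBy; rewrite BV.
have [Ux [m1 _ xE]] : U x /\ range (fun m => g ^+ m) x.
  by move: Bx; rewrite BU => -[].
have [m2 _ yE] := Ay.
have [p [px pU]] := zariski_open_principal oU Ux.
have [q [qy qV]] := zariski_open_principal (closed_openC cV) Vy.
have [[P PE] [R RE]] := (Q p, Q q).
have PR0 : P * R != 0.
  rewrite mulf_neq0 //; [move: px|move: qy]; rewrite /principal_open /=.
    by rewrite -xE PE; apply: contra => /eqP ->; rewrite horner0.
  by rewrite -yE RE; apply: contra => /eqP ->; rewrite horner0.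
move/eqP: PR0; apply; apply: (poly_roots_inj (natr_injective char0)) => m.
apply: contrapT => /eqP; rewrite hornerM mulf_eq0 negb_or -PE -RE => /andP[Um Vm].
have : B (g ^+ m) by rewrite BU; split; [exists m|apply: pU].
by rewrite BV => -[_]; apply: qV.
Qed.

End UnipotentPowers.

Lemma unipotent_mul_entry (F : fieldType) n (g g' : 'M[F]_n) (i j l : 'I_n) :
    j = i.+1 :> nat -> l = j.+1 :> nat -> unipotent g -> unipotent g' ->
  (g *m g') i l = g' i l + g i j * g' j l + g i l.
Proof.
move=> ij jl ug ug'.
have ne_ji : j != i by rewrite -val_eqE /= ij eqn_leq ltnn.
have ne_li : l != i by rewrite -val_eqE /= jl ij eqn_leq ltnNge leqnSn.
have ne_lj : l != j by rewrite -val_eqE /= jl eqn_leq ltnn.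
rewrite mxE (bigD1 i) //= (bigD1 j) //= (bigD1 l) ?ne_li //= big1 ?addr0.
  by rewrite (ug i i) // (ug' l l) // !eqxx mul1r mulr1 addrA.
move=> m /andP[/andP[mi mj] ml]; have [lt_mi|le_im] := ltnP m i.
  by rewrite (ug i m) ?(ltnW lt_mi) // eq_sym (negPf mi) mul0r.
rewrite (ug' m l) ?(negPf ml) ?mulr0 //.
have lt_im : (i < m)%N by rewrite ltn_neqAle val_eqE eq_sym mi.
by rewrite jl ltn_neqAle val_eqE eq_sym mj ij.
Qed.

Section VirtuallyAbelian.
Variables (C M : fieldType) (iota : {rmorphism {fraction {poly C}} -> M}).
Variable d : M -> M.
Hypothesis Md : differential_extension iota d.
Hypothesis char0 : forall n, n.+1%:R != 0 :> C.

Local Notation cst := (const_in iota).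

Variable K : set M.
Hypotheses (sK : subfield K) (Kc : forall c, K (cst c)).
Hypothesis dK : forall x, K x -> K (d x).

(** The system is equivalent over K to a unipotent one, with matrix A. Consider
two consecutive entries f, h just above the diagonal of a unipotent fundamental
matrix T: on them, an automorphism acts by translations. If f and h were
independent over K, there would be an automorphism translating f only, and one
translating h only; both are unipotent, hence in the identity component, and
they do not commute. *)
Lemma virtually_abelian_relation (k : set M) n (A B P Q : 'M[M]_n) G f h
    (i j l : 'I_n) :
    (forall c, k (cst c)) -> k `<=` K ->
    strictly_upper A -> (forall a b, K (A a b)) -> (forall a b, K (P a b)) ->
    Q *m P = 1%:M -> map_mx d P + P *m A = B *m P ->
    is_galois_group iota d k B G -> virtually_abelian G ->
    j = i.+1 :> nat -> l = j.+1 :> nat -> d f = A i j -> d h = A j l ->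
  K f \/ exists e, K (h - cst e * f).
Proof.
move=> kc kK uA KA KP QP dP [F [Fu dF] ->{G}] abG ij jl df dh.
have PQ := mulmx1C QP.
(* F = P T H, with T unipotent and H constant. *)
have dU : map_mx d (Q *m F) = A *m (Q *m F).
  have eF : F = P *m (Q *m F) by rewrite mulmxA PQ mul1mx.
  have := dF; rewrite {1 2}eF (der_mulmx Md) (mulmxA B) -dP mulmxDl => /addrI.
  by rewrite -(mulmxA P) => /(congr1 (mulmx Q)); rewrite !(mulmxA Q) QP !mul1mx.
have Qu : Q \in unitmx by case/mulmx1_unit: QP.
have Uu : Q *m F \in unitmx by rewrite unitmx_mul Qu Fu.
have fU : row_free (Q *m F) by rewrite row_free_unit.
have [T [uT dT]] := unipotent_solution Md uA dU fU.
have Tu := unipotent_unitmx uT.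
have [H UH] := solution_quotient_const Md Tu dT dU.
have Hu : H \in unitmx.
  by rewrite -(map_unitmx cst); move: Uu; rewrite UH unitmx_mul => /andP[].
have eF : F = P *m T *m map_mx cst H by rewrite -mulmxA -UH mulmxA PQ mul1mx.
have [//|Kf] := pselect (K f); first by left.
right; apply: contrapT => noe.
have {noe}Kh e : ~ K (h - cst e * f) by move=> Ke; apply: noe; exists e.
have Tf : exists c, T i j = f + cst c.
  have [c e] : exists c, T i j - f = cst c; last by exists c; rewrite -e addrC subrK.
  apply/(der_eq0 Md); rewrite (derB Md) df; have /matrixP/(_ i j) := dT.
  rewrite mxE => ->; rewrite mxE (bigD1 j) //= (uT j j) // eqxx mulr1 big1.
    by rewrite addr0 subrr.
  move=> m mj; have [le_mi|lt_im] := leqP m i; first by rewrite uA // mul0r.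
  by rewrite uT ?(negPf mj) ?mulr0 // ij.
have Th : exists c, T j l = h + cst c.
  have [c e] : exists c, T j l - h = cst c; last by exists c; rewrite -e addrC subrK.
  apply/(der_eq0 Md); rewrite (derB Md) dh; have /matrixP/(_ j l) := dT.
  rewrite mxE => ->; rewrite mxE (bigD1 l) //= (uT l l) // eqxx mulr1 big1.
    by rewrite addr0 subrr.
  move=> m mj; have [le_mi|lt_im] := leqP m j; first by rewrite uA // mul0r.
  by rewrite uT ?(negPf mj) ?mulr0 // jl.
have Kdf : K (d f) by rewrite df.
have Kdh : K (d h) by rewrite dh.
have translate a b : exists g : 'M[C]_n, [/\ unipotent g, g i j = a, g j l = b
    & identity_component (galois_mx iota d k F) (invmx H *m g *m H)].
  have [S [aS SK Sf Sh]] := independent_translations Md char0 sK Kc dK Kdf Kdh Kf a b Kh.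
  have [|S' [g [aS' SS' ug Sg]]] := extend_unipotent_solution Md char0 aS uA _ uT dT.
    by move=> a' b'; apply: SK.
  have gE (p q : 'I_n) x c : q = p.+1 :> nat -> (exists c', T p q = x + cst c') ->
      S' x (x + cst c) -> g p q = c.
    move=> pq [c' Tx] Sx; have := Sg p q.
    have -> : (T *m map_mx cst g) p q = T p q + cst (g p q).
      have qp : p != q by rewrite -val_eqE /= pq eqn_leq ltnn andbF.
      rewrite mxE (bigD1 q) //= (bigD1 p) //= big1 ?addr0 => [|m /andP[mq mp]].
        by rewrite !mxE (uT p p) // (ug q q) // !eqxx rmorph1 mul1r mulr1.
      rewrite mxE; have [lt_mp|le_pm] := ltnP m p.
        by rewrite uT ?(ltnW lt_mp) // eq_sym (negPf mp) mul0r.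
      rewrite (ug m q) ?(negPf mq) ?rmorph0 ?mulr0 // pq ltn_neqAle le_pm andbT.
      by rewrite eq_sym.
    rewrite Tx => /(aut_fun aS' (autD aS' Sx (aut_const aS' c'))) /eqP.
    by rewrite addrAC => /eqP/addrI/fmorph_inj.
  exists g; split=> //.
  - by apply: (gE i j f); [|exact: Tf|apply: SS'].
  - by apply: (gE j l h); [|exact: Th|apply: SS'].
  set y := invmx H *m g *m H.
  have yu : y \in unitmx.
    by rewrite !unitmx_mul unitmx_inv Hu (unipotent_unitmx ug).
  have Sy : rel_mx S' F (F *m map_mx cst y).
    have -> : F *m map_mx cst y = P *m (T *m map_mx cst g) *m map_mx cst H.
      rewrite {1}eF /y !map_mxM !mulmxA -(mulmxA _ (map_mx cst H)) -map_mxM.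
      by rewrite mulmxV // map_mx1 mulmx1.
    rewrite {1}eF; apply: (rel_mulmx aS'); last exact: (rel_mx_const aS' H).
    by apply: (rel_mulmx aS') => // a' b'; apply/SS'/SK/KP.
  have kS' x : k x -> S' x x by move=> kx; apply/SS'/SK/kK.
  (* The powers of y form a connected subset of the group containing 1. *)
  have nil : (y - 1) ^+ n = 0.
    have -> : y - 1 = invmx H *m (g - 1) *m H.
      by rewrite mulmxBr mulmxBl mulmx1 mulVmx.
    have E m : (invmx H *m (g - 1) *m H) ^+ m = invmx H *m (g - 1) ^+ m *m H.
      elim: m => [|m IH]; first by rewrite !expr0 mulmx1 mulVmx.
      rewrite !exprS IH -!mulmxE !mulmxA; congr (_ *m _ *m _).
      by rewrite mulmxK.
    rewrite E strictly_upper_nilpotent ?mulmx0 ?mul0mx // => a' b' le_ba.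
    by rewrite mxE ug // !mxE subrr.
  have into_component := connected_component_max _ _ (unipotent_powers_connected char0 nil).
  apply: into_component; last by exists 1%N; rewrite // expr1.
    by exists 0%N; rewrite // expr0.
  by move=> _ [m _ <-]; apply: galois_power kc kS' yu Sy.
have [g [ug gij gjl Ig]] := translate 1 0.
have [g' [ug' gij' gjl' Ig']] := translate 0 1.
have := abG _ _ Ig Ig'; rewrite !mulmxA => /(congr1 (mulmx^~ (invmx H))).
rewrite !mulmxK // -!(mulmxA (invmx H)) => /(congr1 (mulmx H)).
rewrite !mulKVmx // => /matrixP/(_ i l).
rewrite !(unipotent_mul_entry ij jl) // gij gjl gij' gjl' !mul1r mul0r addr0.
rewrite [g i l + _]addrC => /addIr/eqP.
by rewrite -subr_eq0 addrAC subrr add0r oner_eq0.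
Qed.

(** Which entries are consecutive depends on the order of the unknowns; a
permutation s of them is a change of basis over the constants. *)
Lemma virtually_abelian_relation_perm (k : set M) n (s : 'S_n) (A B P Q : 'M[M]_n)
    G f h (i j l : 'I_n) :
    (forall c, k (cst c)) -> k `<=` K ->
    strictly_upper (\matrix_(a, b) A (s a) (s b)) ->
    (forall a b, K (A a b)) -> (forall a b, K (P a b)) ->
    Q *m P = 1%:M -> map_mx d P + P *m A = B *m P ->
    is_galois_group iota d k B G -> virtually_abelian G ->
    j = i.+1 :> nat -> l = j.+1 :> nat ->
    d f = A (s i) (s j) -> d h = A (s j) (s l) ->
  K f \/ exists e, K (h - cst e * f).
Proof.
move=> kc kK uA KA KP QP dP GB abG ij jl df dh.
have sA : \matrix_(a, b) A (s a) (s b) = perm_mx s *m A *m perm_mx s^-1%g.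
  by rewrite -row_permE -col_permE; apply/matrixP => a b; rewrite !mxE.
apply: (@virtually_abelian_relation k n (\matrix_(a, b) A (s a) (s b)) B
  (P *m perm_mx s^-1%g) (perm_mx s *m Q) G f h i j l) => //.
- by move=> a b; rewrite mxE.
- by move=> a b; rewrite -col_permE mxE.
- by rewrite -mulmxA (mulmxA Q) QP mul1mx -perm_mxM mulgV perm_mx1.
- rewrite sA -!mulmxA (mulmxA (perm_mx s^-1%g)) -perm_mxM mulVg perm_mx1 mul1mx.
  rewrite !mulmxA -dP mulmxDl; congr (_ + _).
  by rewrite -!col_permE map_col_perm.
- by rewrite mxE.
- by rewrite mxE.
Qed.

End VirtuallyAbelian.

(** * Functions algebraic over C(z) *)

Section AlgebraicFunctions.
Variables (C M : fieldType) (iota : {rmorphism {fraction {poly C}} -> M}).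
Variable d : M -> M.
Hypothesis Md : differential_extension iota d.
Hypothesis char0 : forall n, n.+1%:R != 0 :> C.

Local Notation cst := (const_in iota).

Definition algebraic_functions : set M := [set x | algebraicOver iota x].
Local Notation K := algebraic_functions.

Lemma algebraic_subfield : subfield K.
Proof.
split=> [|x y|x y]; [exact: algebraic1|exact: algebraic_sub|exact: algebraic_div].
Qed.

Lemma algebraic_const c : K (cst c).
Proof. exact: algebraic_id. Qed.

Lemma fraction_quotient (R : idomainType) (x : {fraction R}) :
  exists2 nd : R * R, nd.2 != 0 & x = tofrac nd.1 / tofrac nd.2.
Proof.
pose a := generic_quotient.repr x; have a0 : \d_a != 0 by apply: denom_ratioP.
exists (val a) => //; apply: (canRL (mulfK _)); first by rewrite tofrac_eq0.
rewrite -[x]generic_quotient.reprK -/a; unlock FracField.tofrac; rewrite -[LHS]FracField.pi_mul.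
apply/eqP; rewrite FracField.equivf_def /FracField.mulf.
by rewrite !numden_Ratio ?oner_neq0 ?mulf_neq0 ?mulr1 ?oner_neq0 // mulrC.
Qed.

Lemma der_rational a : exists b, d (iota a) = iota b.
Proof.
have P p : exists b, d (iota (tofrac p)) = iota b.
  elim/poly_ind: p => [|p c [b IH]]; first by exists 0; rewrite !rmorph0 (der0 Md).
  exists (b * tofrac 'X + tofrac p).
  rewrite !rmorphD !rmorphM (derD Md) (derM Md) IH (der_z Md) mulr1.
  by rewrite -/(const_in iota c) (der_const Md) addr0.
have [[p q] /= q0 ->] := fraction_quotient a.
have [[b1 e1] [b2 e2]] := (P p, P q).
exists (b1 / tofrac q - tofrac p * (b2 / (tofrac q) ^+ 2)).
rewrite rmorphM fmorphV (derM Md) (derV Md) e1 e2.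
by rewrite rmorphB !rmorphM !fmorphV rmorphXn; ring.
Qed.

(** Differentiate a relation p(x) = 0; if p'(x) = 0, then p' is a relation of
smaller degree. *)
Lemma algebraic_der x : K x -> K (d x).
Proof.
case=> p p0 px; have [n le_pn] := ubnP (size p).
elim: n p p0 px le_pn => // n IH p p0 /rootP px le_pn.
have sp : (1 < size p)%N.
  rewrite ltnNge; apply/negP => /size1_polyC e; move: px p0; rewrite e map_polyC hornerC.
  by move=> /eqP; rewrite fmorph_eq0 polyC_eq0 => ->.
have p'0 : p^`() != 0.
  apply: contraTneq sp => /polyP/(_ (size p).-2); rewrite coef_deriv coef0 => /eqP.
  case E : (size p) => [|[|m]] //=; rewrite -mulr_natr mulf_eq0.
  have -> : p`_m.+1 = lead_coef p by rewrite lead_coefE E.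
  rewrite lead_coef_eq0 (negPf p0) /= -(fmorph_eq0 iota) rmorph_nat.
  by rewrite (negPf (charM0 iota char0 _)).
have := congr1 d px; rewrite (der_horner Md) (der0 Md) deriv_map => /eqP.
have [e|p'x] := eqVneq (map_poly iota p^`()).[x] 0.
  move=> _; apply: (IH p^`()) => //; first exact/rootP.
  by rewrite (leq_trans (lt_size_deriv p0)).
rewrite addrC addr_eq0 mulrC => /eqP/(canRL (mulfK p'x)) ->.
have alg_x : K x by exists p => //; apply/rootP.
have sK := algebraic_subfield.
apply: (subfDiv sK); [apply: (subfN sK)|]; apply: (subf_horner sK) => // i.
  rewrite coef_map_id0 ?(der0 Md) // coef_map.
  by have [b ->] := der_rational p`_i; apply: algebraic_id.
by rewrite coef_map; apply: algebraic_id.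
Qed.

Lemma algebraic_root m (x : M) (a : {fraction {poly C}}) :
  (0 < m)%N -> x ^+ m = iota a -> K x.
Proof.
move=> m0 xm; exists ('X^m - a%:P); first by rewrite -size_poly_eq0 size_XnsubC.
by apply/rootP; rewrite rmorphB /= map_polyXn map_polyC hornerD hornerN hornerXn hornerC xm subrr.
Qed.

Lemma omega_algebraic (k : int) (w : M) : k != 0 -> is_omega iota k w -> K w.
Proof.
move=> k0 [a [b [ha hb ->]]]; apply: (subfM algebraic_subfield); last first.
  apply: (@algebraic_root 4 _ ((tofrac 'X - 1) ^- 5)) => //.
  by rewrite hb fmorphV rmorphXn rmorphB rmorph1.
have e : a ^ (2 * k) = iota (tofrac 'X ^ (- (3 * k + 1))) by rewrite ha fmorphXz.
have : 2 * k != 0 by rewrite mulf_neq0.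
case: (2 * k) e => m e m0.
  by apply: (@algebraic_root m) e; rewrite lt0n.
apply: (@algebraic_root m.+1 _ (tofrac 'X ^ (- (3 * k + 1)))^-1) => //.
by rewrite fmorphV -e invrK.
Qed.

Lemma K_0_algebraic (k : int) (w : M) : k != 0 -> is_omega iota k w -> K_0 iota w `<=` K.
Proof.
move=> k0 hw; apply: field_generated_min; first exact: algebraic_subfield.
move=> x [[a _ <-]|->]; [exact: algebraic_id|exact: omega_algebraic hw].
Qed.

Lemma K_0_const w c : K_0 iota w (cst c).
Proof. by apply: sub_field_generated; left; exists (tofrac c%:P). Qed.

(** * Equations with Galois group G_a *)

(** If all the entries of a fundamental matrix F were algebraic, the entries of
F g would, for g in the group, be among finitely many conjugates; along the
group (C, +) they are polynomials in the parameter, so they would be constant. *)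
Lemma Ga_not_algebraic n (B F : 'M[M]_n) :
    fundamental_matrix d B F ->
    isomorphic_to_Ga (identity_component (galois_mx iota d (range iota) F)) ->
  ~ forall i j, K (F i j).
Proof.
move=> [Fu _] [phi [p [m [_ evG evK]]]] KF; set ev := fun t => map_mx _ phi in evG evK.
pose e i j : {poly M} := \sum_l (F i l)%:P * map_poly cst (phi l j).
have eE t i j : (F *m map_mx cst (ev t)) i j = (e i j).[cst t].
  rewrite mxE horner_sum; apply: eq_bigr => l _.
  by rewrite !mxE hornerM hornerC horner_map.
have e_const i j : (size (e i j) <= 1)%N.
  have [q q0 qF] := KF i j; rewrite leqNgt; apply/negP => se.
  have := comp_poly_eq0 (map_poly iota q) se; rewrite map_poly_eq0 (negPf q0).
  move/negbT/negP; apply; apply/eqP.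
  apply: (poly_roots_inj (natr_injective (charM0 iota char0))) => N.
  rewrite horner_comp -(rmorph_nat cst) -eE.
  have : galois_mx iota d (range iota) F (ev N%:R).
    have : range ev (ev N%:R) by exists N%:R.
    by rewrite evG; apply: connected_component_sub.
  move=> [s sA /matrixP/(_ i j)]; rewrite mxE => <-.
  set L := field_generated _ in sA; have sL : subfield L by apply: field_generated_subfield.
  have LF : L (F i j) by apply: sub_field_generated; right; exists i, j.
  have Lc a : L (iota a) by apply: sub_field_generated; left; exists a.
  have s_fix a : s (iota a) = iota a by apply: (aut_fix sA); rewrite inE; exists a.
  have Lp r : L (map_poly iota r).[F i j].
    by apply: (subf_horner sL); [move=> l; rewrite coef_map; apply: Lc|apply: LF].
  have sp r : s (map_poly iota r).[F i j] = (map_poly iota r).[s (F i j)].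
    elim/poly_ind: r => [|r c IH].
      by rewrite rmorph0 !horner0 -(rmorph0 iota) s_fix.
    rewrite rmorphD rmorphM /= map_polyX map_polyC !hornerE /=.
    have [LrF LF'] := (mem_set (Lp r), mem_set LF).
    rewrite (aut_add sA) ?(mem_set (Lc c)) ?(aut_mul sA) ?IH ?s_fix //.
    by apply: mem_set; apply: (subfM sL); [apply: Lp|apply: LF].
  by rewrite -sp (rootP qF) -(rmorph0 iota) s_fix.
have ev_const t : ev t = ev 0.
  apply: (map_mx_inj (f := cst)); apply: (can_inj (mulKmx Fu)).
  by apply/matrixP => i j; rewrite !eE (size1_polyC (e_const i j)) !hornerC.
have := evK 1; rewrite /= -/(ev 1) ev_const => e1.
have := evK 0; rewrite /= -/(ev 0) e1 => /eqP.
by rewrite oner_eq0.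
Qed.

Section Ga.
Variable r : {fraction {poly C}}.
Hypothesis Ga : galois_component_Ga iota d r.

(** Two independent algebraic solutions would make all solutions algebraic. *)
Lemma Ga_wronskian_eq0 x y :
    K x -> K y -> d (d x) = iota r * x -> d (d y) = iota r * y ->
  x * d y - d x * y = 0.
Proof.
move=> Kx Ky dx dy; apply: contrapT => /eqP W0.
have [G [F Fm ->] Ga_F] := Ga; apply: (Ga_not_algebraic Fm Ga_F).
have [_ dF] := Fm; have sK := algebraic_subfield.
have [dF0 dF1] : (forall j, d (F 0 j) = F 1 j) /\ (forall j, d (F 1 j) = iota r * F 0 j).
  split=> j.
    have /matrixP/(_ 0 j) := dF; rewrite !mxE !big_ord_recl big_ord0 !mxE /=.
    by move=> ->; rewrite mul0r add0r mul1r addr0; congr (F _ j); apply: val_inj.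
  have /matrixP/(_ 1 j) := dF; rewrite !mxE !big_ord_recl big_ord0 !mxE /=.
  by move=> ->; rewrite mul0r !addr0.
have wr u v : d (d u) = iota r * u -> d (d v) = iota r * v ->
    exists c, u * d v - d u * v = cst c.
  by move=> du dv; apply/(der_eq0 Md); rewrite (derB Md) !(derM Md) du dv; ring.
have K0 j : K (F 0 j).
  have dj : d (d (F 0 j)) = iota r * F 0 j by rewrite dF0 dF1.
  have [[a ea] [b eb]] := (wr _ _ dx dj, wr _ _ dy dj).
  have -> : F 0 j = (y * cst a - x * cst b) / (x * d y - d x * y).
    by rewrite -ea -eb; field.
  apply: (subfDiv sK).
    by apply: (subfB sK); apply: (subfM sK) => //; apply: algebraic_const.
  by apply: (subfB sK); apply: (subfM sK) => //; apply: algebraic_der.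
move=> i j; have [->|->] : i = 0 \/ i = 1.
  by case: i => -[|[|//]] lt_i; [left|right]; apply: val_inj.
- exact: K0.
- by rewrite -dF0; apply: algebraic_der.
Qed.

(** With w the solution defining I, w I is a second solution, independent of
w. *)
Lemma Ga_integral_not_algebraic I : is_I_nu iota d r I -> ~ K I.
Proof.
move=> [w [w0 dw Kw] dI] KI.
have d2 : d (w * I) = d w * I + w^-1 by rewrite (derM Md) dI; field.
have dd2 : d (d (w * I)) = iota r * (w * I).
  by rewrite d2 (derD Md) (derM Md) (derV Md) dw dI; field.
have := Ga_wronskian_eq0 Kw (subfM algebraic_subfield Kw KI) dw dd2.
rewrite d2 => /eqP; have -> : w * (d w * I + w^-1) - d w * (w * I) = 1 by field.
by rewrite oner_eq0.
Qed.

(** The algebraic solution defining I is a constant multiple of w, which accounts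
for the constant c. *)
Lemma Ga_integral w I :
    algebraic_solution iota d r w -> is_I_nu iota d r I ->
  exists c, d (cst c * I) = (w ^+ 2)^-1 /\ ~ K (cst c * I).
Proof.
move=> [w0 dw Kw] II; have [v [v0 dv Kv] dI] := II.
have [c ec] : exists c, v / w = cst c.
  apply/(der_eq0 Md); rewrite (derM Md) (derV Md).
  have -> : d v / w + v * (- d w / w ^+ 2) = - (v * d w - d v * w) / w ^+ 2 by field.
  by rewrite Ga_wronskian_eq0 // oppr0 mul0r.
exists (c ^+ 2); split.
  rewrite (derZ Md) dI; have -> : cst (c ^+ 2) = (v / w) ^+ 2 by rewrite ec rmorphXn.
  by field; rewrite v0 w0.
move=> KcI; apply: (Ga_integral_not_algebraic II).
have c0 : cst (c ^+ 2) != 0.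
  rewrite fmorph_eq0 expf_neq0 // -(fmorph_eq0 cst); apply: contra_eq_neq ec => ->.
  by rewrite mulf_neq0 ?invr_neq0.
rewrite -(mulKf c0 I); apply: (subfM algebraic_subfield) => //.
exact/(subfV algebraic_subfield)/algebraic_const.
Qed.

End Ga.
End AlgebraicFunctions.

(** * Gauge transformations *)

Section Gauge.
Variables (C M : fieldType) (iota : {rmorphism {fraction {poly C}} -> M}).
Variable d : M -> M.
Hypothesis Md : differential_extension iota d.

Lemma der_nat n : d n%:R = 0.
Proof. by rewrite -(rmorph_nat (const_in iota)) (der_const Md). Qed.

(** Entry j of the product of a row by a matrix given by its rows, as a term that
reduces by computation to an explicit sum. *)
Fixpoint row_mul (row : seq M) (rows : seq (seq M)) (j : nat) : M :=
  match row, rows with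
  | a :: row', r :: rows' => a * r`_j + row_mul row' rows' j
  | _, _ => 0
  end.

Lemma mulmx_rowsE n (ra rb : seq (seq M)) (i j : 'I_n) : (size rb <= n)%N ->
  (mx_of_rows n ra *m mx_of_rows n rb) i j = row_mul (nth [::] ra i) rb j.
Proof.
move=> le_n; rewrite mxE.
transitivity (\sum_(l < n) (nth [::] ra i)`_l * (nth [::] rb l)`_j).
  by apply: eq_bigr => l _; rewrite !mxE.
move: (nth [::] ra i) (nat_of_ord j) => row m {i j}.
elim: n rb row le_n => [|n IH] [|r rb] row //= le_n.
- by rewrite big_ord0; case: row.
- by rewrite big1 => [|l _]; [case: row|rewrite !nth_nil mulr0].
rewrite big_ord_recl; case: row => [|a row] /=; last by rewrite IH.
by rewrite mul0r add0r big1 // => l _; rewrite mul0r.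
Qed.

Section VE.
Variables (w ra rg x y : M).
Hypotheses (x0 : x != 0) (y0 : y != 0).
Hypotheses (dx : d (d x) = ra * x) (dy : d (d y) = rg * y).

(** Here x and y are fixed algebraic solutions; write X, Y for the unknowns of
the system. Then X = x v, with v' = W / x^2 and W = x X' - x' X; and Y = y p,
with p' = q / y^2 and q = y Y' - y' Y. In the coordinates p, q, v^2, v W, W^2, v,
W the system is unipotent, with the following matrix. *)
Definition VE_unip : 'M[M]_7 := mx_of_rows 7
    [:: [:: 0; (y ^+ 2)^-1; 0; 0; 0; 0; 0];
        [:: 0; 0; w * y * x ^+ 2; 0; 0; 0; 0];
        [:: 0; 0; 0; 2%:R * (x ^+ 2)^-1; 0; 0; 0];
        [:: 0; 0; 0; 0; (x ^+ 2)^-1; 0; 0];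
        [:: 0; 0; 0; 0; 0; 0; 0];
        [:: 0; 0; 0; 0; 0; 0; (x ^+ 2)^-1];
        [:: 0; 0; 0; 0; 0; 0; 0]].

(** X, X', X^2, X X', X'^2, Y, Y' in terms of these coordinates. *)
Definition VE_gauge : 'M[M]_7 := mx_of_rows 7
    [:: [:: 0; 0; 0; 0; 0; x; 0];
        [:: 0; 0; 0; 0; 0; d x; x^-1];
        [:: 0; 0; x ^+ 2; 0; 0; 0; 0];
        [:: 0; 0; x * d x; 1; 0; 0; 0];
        [:: 0; 0; d x ^+ 2; 2%:R * d x / x; (x ^+ 2)^-1; 0; 0];
        [:: y; 0; 0; 0; 0; 0; 0];
        [:: d y; y^-1; 0; 0; 0; 0; 0]].

Definition VE_gauge_inv : 'M[M]_7 := mx_of_rows 7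
    [:: [:: 0; 0; 0; 0; 0; y^-1; 0];
        [:: 0; 0; 0; 0; 0; - d y; y];
        [:: 0; 0; (x ^+ 2)^-1; 0; 0; 0; 0];
        [:: 0; 0; - d x / x; 1; 0; 0; 0];
        [:: 0; 0; d x ^+ 2; - (2%:R * x * d x); x ^+ 2; 0; 0];
        [:: x^-1; 0; 0; 0; 0; 0; 0];
        [:: - d x; x; 0; 0; 0; 0; 0]].

Lemma VE_gauge_invK : VE_gauge_inv *m VE_gauge = 1%:M.
Proof.
apply/matrixP => i j; rewrite mulmx_rowsE // mxE -val_eqE.
case: i => [] [|[|[|[|[|[|[|//]]]]]]] hi; case: j => [] [|[|[|[|[|[|[|//]]]]]]] hj;
  rewrite /= ?(mul0r, mulr0, add0r, addr0) //; field; rewrite ?x0 ?y0 //.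
Qed.

Lemma VE_gauge_der :
  map_mx d VE_gauge + VE_gauge *m VE_unip = VE_mx w ra rg *m VE_gauge.
Proof.
apply/matrixP => i j; rewrite mxE mulmx_rowsE // mulmx_rowsE // !mxE.
case: i => [] [|[|[|[|[|[|[|//]]]]]]] hi; case: j => [] [|[|[|[|[|[|[|//]]]]]]] hj;
  rewrite /= ?(mul0r, mulr0, add0r, addr0) ?(der0 Md, der1 Md, der_nat) //;
  rewrite ?expr2 ?(derM Md, derV Md, der_nat) ?dx ?dy ?expr2 ?(derM Md);
  field; rewrite ?x0 ?y0 //.
Qed.

End VE.

Section EX.
Variables (w ra rb rg x y u : M).
Hypotheses (x0 : x != 0) (y0 : y != 0) (u0 : u != 0).
Hypotheses (dx : d (d x) = ra * x) (dy : d (d y) = rb * y) (du : d (d u) = rg * u).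

(** With X = x v, W = x X' - x' X, Y = y s, T = y Y' - y' Y, U = u p and
q = u U' - u' U, the coordinates are p, q, v s, v T, W s, W T, v, W, s, T. *)
Definition EX_unip : 'M[M]_10 := mx_of_rows 10
    [:: [:: 0; (u ^+ 2)^-1; 0; 0; 0; 0; 0; 0; 0; 0];
        [:: 0; 0; w * u * y * x; 0; 0; 0; 0; 0; 0; 0];
        [:: 0; 0; 0; (y ^+ 2)^-1; (x ^+ 2)^-1; 0; 0; 0; 0; 0];
        [:: 0; 0; 0; 0; 0; (x ^+ 2)^-1; 0; 0; 0; 0];
        [:: 0; 0; 0; 0; 0; (y ^+ 2)^-1; 0; 0; 0; 0];
        [:: 0; 0; 0; 0; 0; 0; 0; 0; 0; 0];
        [:: 0; 0; 0; 0; 0; 0; 0; (x ^+ 2)^-1; 0; 0];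
        [:: 0; 0; 0; 0; 0; 0; 0; 0; 0; 0];
        [:: 0; 0; 0; 0; 0; 0; 0; 0; 0; (y ^+ 2)^-1];
        [:: 0; 0; 0; 0; 0; 0; 0; 0; 0; 0]].

(** X, X', Y, Y', X Y, X Y', X' Y, X' Y', U, U' in terms of these coordinates. *)
Definition EX_gauge : 'M[M]_10 := mx_of_rows 10
    [:: [:: 0; 0; 0; 0; 0; 0; x; 0; 0; 0];
        [:: 0; 0; 0; 0; 0; 0; d x; x^-1; 0; 0];
        [:: 0; 0; 0; 0; 0; 0; 0; 0; y; 0];
        [:: 0; 0; 0; 0; 0; 0; 0; 0; d y; y^-1];
        [:: 0; 0; x * y; 0; 0; 0; 0; 0; 0; 0];
        [:: 0; 0; x * d y; x / y; 0; 0; 0; 0; 0; 0];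
        [:: 0; 0; d x * y; 0; y / x; 0; 0; 0; 0; 0];
        [:: 0; 0; d x * d y; d x / y; d y / x; (x * y)^-1; 0; 0; 0; 0];
        [:: u; 0; 0; 0; 0; 0; 0; 0; 0; 0];
        [:: d u; u^-1; 0; 0; 0; 0; 0; 0; 0; 0]].

Definition EX_gauge_inv : 'M[M]_10 := mx_of_rows 10
    [:: [:: 0; 0; 0; 0; 0; 0; 0; 0; u^-1; 0];
        [:: 0; 0; 0; 0; 0; 0; 0; 0; - d u; u];
        [:: 0; 0; 0; 0; (x * y)^-1; 0; 0; 0; 0; 0];
        [:: 0; 0; 0; 0; - d y / x; y / x; 0; 0; 0; 0];
        [:: 0; 0; 0; 0; - d x / y; 0; x / y; 0; 0; 0];
        [:: 0; 0; 0; 0; d x * d y; - (d x * y); - (x * d y); x * y; 0; 0];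
        [:: x^-1; 0; 0; 0; 0; 0; 0; 0; 0; 0];
        [:: - d x; x; 0; 0; 0; 0; 0; 0; 0; 0];
        [:: 0; 0; y^-1; 0; 0; 0; 0; 0; 0; 0];
        [:: 0; 0; - d y; y; 0; 0; 0; 0; 0; 0]].

Lemma EX_gauge_invK : EX_gauge_inv *m EX_gauge = 1%:M.
Proof.
apply/matrixP => i j; rewrite mulmx_rowsE // mxE -val_eqE.
case: i => [] [|[|[|[|[|[|[|[|[|[|//]]]]]]]]]] hi; case: j => [] [|[|[|[|[|[|[|[|[|[|//]]]]]]]]]] hj;
  rewrite /= ?(mul0r, mulr0, add0r, addr0) //; field; rewrite ?x0 ?y0 ?u0 //.
Qed.

Lemma EX_gauge_der :
  map_mx d EX_gauge + EX_gauge *m EX_unip = EX_mx w ra rb rg *m EX_gauge.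
Proof.
apply/matrixP => i j; rewrite mxE mulmx_rowsE // mulmx_rowsE // !mxE.
case: i => [] [|[|[|[|[|[|[|[|[|[|//]]]]]]]]]] hi; case: j => [] [|[|[|[|[|[|[|[|[|[|//]]]]]]]]]] hj;
  rewrite /= ?(mul0r, mulr0, add0r, addr0) ?(der0 Md, der1 Md, der_nat) //;
  rewrite ?expr2 ?(derM Md, derV Md, der_nat) ?dx ?dy ?du ?expr2 ?(derM Md);
  field; rewrite ?x0 ?y0 ?u0 //.
Qed.

End EX.

End Gauge.

(** * The two obstructions *)

Section Conclusion.
Variables (C M : fieldType) (iota : {rmorphism {fraction {poly C}} -> M}).
Variable d : M -> M.
Hypothesis Md : differential_extension iota d.
Hypothesis char0 : forall n, n.+1%:R != 0 :> C.

Local Notation cst := (const_in iota).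
Local Notation K := (algebraic_functions iota).

Variables (k : int) (w : M).
Hypotheses (k0 : k != 0) (omegaP : is_omega iota k w).

Let sK : subfield K := algebraic_subfield iota.
Let Kd x : K x -> K (d x) := @algebraic_der _ _ _ _ Md char0 x.
Let K0c := @K_0_const _ _ iota w.
Let K0K := @K_0_algebraic _ _ iota k w k0 omegaP.
Let Kc := @algebraic_const _ _ iota.
Let Kw : K w := omega_algebraic k0 omegaP.

Lemma relation_sym (f h : M) : ~ K h ->
  K f \/ (exists e, K (h - cst e * f)) -> exists e, K (f - cst e * h).
Proof.
move=> Kh [Kf|[e Ke]]; first by exists 0; rewrite rmorph0 mul0r subr0.
have e0 : e != 0 by apply: contra_notN Kh => /eqP e0; rewrite e0 rmorph0 mul0r subr0 in Ke.
exists e^-1; have -> : f - cst e^-1 * h = - (cst e^-1 * (h - cst e * f)).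
  by rewrite fmorphV; field; rewrite fmorph_eq0.
by apply: (subfN sK); apply: (subfM sK) => //; apply: algebraic_const.
Qed.

Ltac in_K := repeat first [assumption | exact: (subf0 sK) | exact: (subf1 sK)
  | exact: (subf_nat sK) | apply: (subfM sK) | apply: (subfV sK) | apply: (subfX sK)].

Section VEobstruction.
Variables (ra rg : {fraction {poly C}}).
Hypotheses (Ga_a : galois_component_Ga iota d ra) (Ga_g : galois_component_Ga iota d rg).
Variables (x y Phi Ia Ig : M) (G : set 'M[C]_7).
Hypotheses (xP : algebraic_solution iota d ra x) (yP : algebraic_solution iota d rg y).
Hypothesis dPhi : d Phi = w * y * x ^+ 2.
Hypotheses (IaP : is_I_nu iota d ra Ia) (IgP : is_I_nu iota d rg Ig).
Hypothesis GP : is_galois_group iota d (K_0 iota w) (VE_mx w (iota ra) (iota rg)) G.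
Hypothesis abG : virtually_abelian G.

Lemma VE_obstruction : exists dg da : C,
  algebraicOver iota (Phi + cst dg * Ig) /\ algebraicOver iota (Phi + cst da * Ia).
Proof.
have [[x0 dx Kx] [y0 dy Ky]] := (xP, yP).
have [Kdx Kdy] := (Kd Kx, Kd Ky).
have [ca [dIa KIa]] := Ga_integral Md char0 Ga_a xP IaP.
have [cg [dIg KIg]] := Ga_integral Md char0 Ga_g yP IgP.
have uA : strictly_upper (VE_unip w x y).
  by case=> [] [|[|[|[|[|[|[|//]]]]]]] hi [] [|[|[|[|[|[|[|//]]]]]]] hj //= _; rewrite mxE.
have KA i j : K (VE_unip w x y i j).
  rewrite mxE; case: i => [] [|[|[|[|[|[|[|//]]]]]]] hi;
    case: j => [] [|[|[|[|[|[|[|//]]]]]]] hj; rewrite /=; in_K.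
have KP i j : K (VE_gauge d x y i j).
  rewrite mxE; case: i => [] [|[|[|[|[|[|[|//]]]]]]] hi;
    case: j => [] [|[|[|[|[|[|[|//]]]]]]] hj; rewrite /=; in_K.
have rel (f h : M) (i j l : 'I_7) : j = i.+1 :> nat -> l = j.+1 :> nat ->
    d f = VE_unip w x y i j -> d h = VE_unip w x y j l ->
    K f \/ exists e, K (h - cst e * f).
  exact: (virtually_abelian_relation Md char0 sK Kc Kd
  K0c K0K uA KA KP (VE_gauge_invK d x0 y0)
  (VE_gauge_der Md w x0 y0 dx dy) GP abG).
(* Unknowns p, q, v^2: the solutions with X = x. *)
have [e1 Ke1] : exists e, K (Phi - cst e * (cst cg * Ig)).
  by case: (rel (cst cg * Ig) Phi (@Ordinal 7 0 isT) (@Ordinal 7 1 isT)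
    (@Ordinal 7 2 isT)) => [||||/KIg|] //; rewrite mxE.
(* Unknowns q, v^2, v W: the term linear in x I_alpha of the solutions with
X = x + x I_alpha; the factor 2 is that of the double product. *)
have [e2 Ke2] : exists e, K (Phi - cst e * (2%:R * (cst ca * Ia))).
  apply: relation_sym.
    move=> K2; apply: KIa; rewrite -(mulKf (charM0 iota char0 1) (cst ca * Ia)).
    by apply: (subfM sK) K2; apply: (subfV sK); apply: (subf_nat sK).
  apply: (rel Phi _ (@Ordinal 7 1 isT) (@Ordinal 7 2 isT) (@Ordinal 7 3 isT)) => //.
  - by rewrite dPhi mxE.
  - by rewrite -[X in d (X * _)](rmorph_nat cst) (derZ Md) dIa rmorph_nat mxE.
exists (- (e1 * cg)), (- (e2 * (2%:R * ca))); split.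
  by rewrite rmorphN rmorphM mulNr -mulrA.
by rewrite rmorphN !rmorphM rmorph_nat mulNr -!mulrA.
Qed.

End VEobstruction.

Section EXobstruction.
Variables (ra rb rg : {fraction {poly C}}).
Hypotheses (Ga_a : galois_component_Ga iota d ra) (Ga_b : galois_component_Ga iota d rb).
Hypothesis Ga_g : galois_component_Ga iota d rg.
Variables (x y u Phi Ia Ib Ig : M) (G : set 'M[C]_10).
Hypotheses (xP : algebraic_solution iota d ra x) (yP : algebraic_solution iota d rb y).
Hypothesis uP : algebraic_solution iota d rg u.
Hypothesis dPhi : d Phi = w * u * y * x.
Hypotheses (IaP : is_I_nu iota d ra Ia) (IbP : is_I_nu iota d rb Ib).
Hypothesis IgP : is_I_nu iota d rg Ig.
Hypothesis GP :
  is_galois_group iota d (K_0 iota w) (EX_mx w (iota ra) (iota rb) (iota rg)) G.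
Hypothesis abG : virtually_abelian G.

Lemma EX_obstruction : exists dg db da : C,
  [/\ algebraicOver iota (Phi + cst dg * Ig),
      algebraicOver iota (Phi + cst db * Ib)
    & algebraicOver iota (Phi + cst da * Ia)].
Proof.
have [[x0 dx Kx] [y0 dy Ky] [u0 du Ku]] := And3 xP yP uP.
have [Kdx Kdy Kdu] := And3 (Kd Kx) (Kd Ky) (Kd Ku).
have [ca [dIa KIa]] := Ga_integral Md char0 Ga_a xP IaP.
have [cb [dIb KIb]] := Ga_integral Md char0 Ga_b yP IbP.
have [cg [dIg KIg]] := Ga_integral Md char0 Ga_g uP IgP.
pose A := EX_unip w x y u.
have KA i j : K (A i j).
  rewrite mxE; case: i => [] [|[|[|[|[|[|[|[|[|[|//]]]]]]]]]] hi;
    case: j => [] [|[|[|[|[|[|[|[|[|[|//]]]]]]]]]] hj; rewrite /=; in_K.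
have KP i j : K (EX_gauge d x y u i j).
  rewrite mxE; case: i => [] [|[|[|[|[|[|[|[|[|[|//]]]]]]]]]] hi;
    case: j => [] [|[|[|[|[|[|[|[|[|[|//]]]]]]]]]] hj; rewrite /=; in_K.
have rel (s : 'S_10) (f h : M) (i j l : 'I_10) :
    strictly_upper (\matrix_(a, b) A (s a) (s b)) ->
    j = i.+1 :> nat -> l = j.+1 :> nat ->
    d f = A (s i) (s j) -> d h = A (s j) (s l) ->
    K f \/ exists e, K (h - cst e * f).
  move=> uA; exact: (virtually_abelian_relation_perm Md char0 sK
    Kc Kd K0c K0K uA KA KP
    (EX_gauge_invK d x0 y0 u0) (EX_gauge_der Md w x0 y0 u0 dx dy du) GP abG).
have uA1 : strictly_upper (\matrix_(a, b) A ((1%g : 'S_10) a) ((1%g : 'S_10) b)).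
  move=> a b; rewrite mxE !perm1 mxE.
  by case: a b => [] [|[|[|[|[|[|[|[|[|[|//]]]]]]]]]] ha
                 [] [|[|[|[|[|[|[|[|[|[|//]]]]]]]]]] hb.
(* Exchanging v T and W s makes the entry of I_alpha consecutive to that of
Phi, as is the entry of I_beta in the original order. *)
pose s : 'S_10 := tperm (@Ordinal 10 3 isT) (@Ordinal 10 4 isT).
have uAs : strictly_upper (\matrix_(a, b) A (s a) (s b)).
  move=> a b; rewrite mxE mxE !permE.
  by case: a b => [] [|[|[|[|[|[|[|[|[|[|//]]]]]]]]]] ha
                 [] [|[|[|[|[|[|[|[|[|[|//]]]]]]]]]] hb.
(* Unknowns p, q, v s. *)
have [e1 Ke1] : exists e, K (Phi - cst e * (cst cg * Ig)).
  by case: (rel 1%g (cst cg * Ig) Phi (@Ordinal 10 0 isT) (@Ordinal 10 1 isT)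
    (@Ordinal 10 2 isT)) => [|||||/KIg|] //; rewrite !perm1 mxE.
(* Unknowns q, v s, v T. *)
have [e2 Ke2] : exists e, K (Phi - cst e * (cst cb * Ib)).
  apply: relation_sym => //; apply: (rel 1%g Phi (cst cb * Ib)
    (@Ordinal 10 1 isT) (@Ordinal 10 2 isT) (@Ordinal 10 3 isT)) => //;
  by rewrite !perm1 mxE.
(* Unknowns q, v s, W s. *)
have [e3 Ke3] : exists e, K (Phi - cst e * (cst ca * Ia)).
  apply: relation_sym => //; apply: (rel s Phi (cst ca * Ia)
    (@Ordinal 10 1 isT) (@Ordinal 10 2 isT) (@Ordinal 10 3 isT)) => //;
  by rewrite !permE mxE.
exists (- (e1 * cg)), (- (e2 * cb)), (- (e3 * ca)).
by split; rewrite rmorphN rmorphM mulNr -mulrA.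
Qed.

End EXobstruction.
End Conclusion.

Theorem proposition5 (R : realType) (M : fieldType)
    (iota : {rmorphism {fraction {poly R[i]}} -> M}) (d : M -> M)
    (Md : differential_extension iota d)
    (k : int) (k_ge3 : (3 <= `|k|)%N)
    (omega : M) (omegaP : is_omega iota k omega)
    (la lb lg : R[i])
    (Ga_a : galois_component_Ga iota d (r_nu k la))
    (Ga_b : galois_component_Ga iota d (r_nu k lb))
    (Ga_g : galois_component_Ga iota d (r_nu k lg)) :
  let ra := r_nu k la in
  let rb := r_nu k lb in
  let rg := r_nu k lg in
  (forall (x1 y1 Phi Ia Ig : M) (G : set 'M[R[i]]_7),
     algebraic_solution iota d ra x1 ->
     algebraic_solution iota d rg y1 ->
     d Phi = omega * y1 * x1 ^+ 2 ->
     is_I_nu iota d ra Ia -> is_I_nu iota d rg Ig ->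
     is_galois_group iota d (K_0 iota omega)
       (VE_mx omega (iota ra) (iota rg)) G ->
     virtually_abelian G ->
     exists dg da : R[i],
       algebraicOver iota (Phi + const_in iota dg * Ig) /\
       algebraicOver iota (Phi + const_in iota da * Ia))
  /\
  (forall (x1 y1 u1 Phi Ia Ib Ig : M) (G : set 'M[R[i]]_10),
     algebraic_solution iota d ra x1 ->
     algebraic_solution iota d rb y1 ->
     algebraic_solution iota d rg u1 ->
     d Phi = omega * u1 * y1 * x1 ->
     is_I_nu iota d ra Ia -> is_I_nu iota d rb Ib -> is_I_nu iota d rg Ig ->
     is_galois_group iota d (K_0 iota omega)
       (EX_mx omega (iota ra) (iota rb) (iota rg)) G ->
     virtually_abelian G ->
     exists dg db da : R[i],
       [/\ algebraicOver iota (Phi + const_in iota dg * Ig),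
           algebraicOver iota (Phi + const_in iota db * Ib)
         & algebraicOver iota (Phi + const_in iota da * Ia)]).
Proof.
have char0 n : n.+1%:R != 0 :> R[i] by rewrite pnatr_eq0.
have k0 : k != 0 by case: k k_ge3 {omegaP Ga_a Ga_b Ga_g} => [[]|].
move=> ra rb rg; split.
- move=> x1 y1 Phi Ia Ig G x1P y1P dPhi IaP IgP GP abG.
  exact: (VE_obstruction Md char0 k0 omegaP Ga_a Ga_g x1P y1P dPhi IaP IgP GP abG).
- move=> x1 y1 u1 Phi Ia Ib Ig G x1P y1P u1P dPhi IaP IbP IgP GP abG.
  exact: (EX_obstruction Md char0 k0 omegaP Ga_a Ga_b Ga_g x1P y1P u1P dPhi
    IaP IbP IgP GP abG).
Qed.
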